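(* Let $\nu$ be a symmetric Lévy measure on $\mathbb{R}$ absolutely continuous with respect to the Lebesgue measure, with density $f=\frac{d\nu}{dx}$. Let $\varepsilon\in(0,1]$, $\alpha\in[1,2)$, $M>0$, $f\in\mathscr L_{M,\alpha}$ and $0<t<(\varepsilon/2)^\alpha\big(1\wedge\frac{2-\alpha}{2M}\big)$. Then there exists a constant $\mathrm{E}_1>0$, depending only on $\alpha$, explicitly $$\mathrm{E}_1=\frac{4e^{2+1/e}}{(2-\alpha)^2}+\frac{4^{1+\alpha}}{\alpha^2}+\frac{2^{\alpha+1}}{9\alpha(2-\alpha)},$$ such that, if $\alpha\in(1,2)$, $$\mathbb{P}(|M_t(\varepsilon)|\geq\varepsilon)\leq\frac{2^{2+\alpha}M t^{1+1/\alpha}}{\varepsilon^{1+\alpha}}\Big(1+\frac{M}{\alpha(2-\alpha)(\alpha-1)}\Big)+2t^2M^2\mathrm{E}_1\varepsilon^{-2\alpha},$$ and, if $\alpha=1$, $$\mathbb{P}(M_t(\varepsilon)\geq\varepsilon)\leq\frac{4t^2M^2}{\varepsilon^2}\Big(e^{2+1/e}+\frac{37}{9}\Big)+\frac{4Mt^2}{\varepsilon^2}+\frac{16M^2}{\varepsilon^2}t^2\ln\Big(\frac{\varepsilon}{2t}\Big).$$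
   Context: A Lévy measure is a Borel measure $\nu$ on $\mathbb{R}$ with $\nu(\{0\})=0$ and $\int_{\mathbb{R}}(y^2\wedge 1)\nu(dy)<\infty$; $a\wedge b=\min(a,b)$. For $M>0$ and $\alpha\in(0,2)$, $\mathscr L_{M,\alpha}$ is the class of functions $f$ with $f(x)\leq M|x|^{-(1+\alpha)}$ for all $0<|x|\leq 2$. For $\varepsilon\in(0,1]$, $M(\varepsilon)=(M_t(\varepsilon))_{t\ge0}$ is the Lévy process of the centered (compensated) jumps of size at most $\varepsilon$ of a Lévy process $X$ with Lévy measure $\nu$: $$M_t(\varepsilon)=\lim_{\eta\to0}\Big(\sum_{s\le t}\Delta X_s\mathbf 1_{\eta<|\Delta X_s|\le\varepsilon}-t\int_{\eta<|x|\le\varepsilon}x\,\nu(dx)\Big),\qquad \Delta X_s=X_s-\lim_{u\uparrow s}X_u;$$ equivalently $\mathbb{E}[e^{iuM_t(\varepsilon)}]=\exp\big(t\int_{|x|\le\varepsilon}(e^{iux}-1-iux)\nu(dx)\big)$. (The constant $M$ and the process $M_t(\varepsilon)$ are unrelated.) *)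

(* Defs.v *)
From HB Require Import structures.
From mathcomp Require Import all_boot all_order all_algebra complex.
From mathcomp Require Import all_classical all_reals all_analysis.

Import Order.TTheory GRing.Theory Num.Theory.
Import numFieldNormedType.Exports.

Local Open Scope classical_set_scope.
Local Open Scope complex_scope.
Local Open Scope ring_scope.

Definition cexp {R : realType} (z : R[i]) : R[i] :=
  (expR (complex.Re z))%:C * (cos (complex.Im z) +i* sin (complex.Im z)).

(* Meaningful only if the real and imaginary parts are integrable. *)
Definition Cintegral {d : measure_display} {T : measurableType d}
    {R : realType} (mu : {measure set T -> \bar R}) (D : set T)
    (g : T -> R[i]) : R[i] :=
  Rintegral mu D (fun x => complex.Re (g x)) +i*
  Rintegral mu D (fun x => complex.Im (g x)).

Definition charfun {d : measure_display} {T : measurableType d}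
    {R : realType} (P : probability T R) (X : T -> R) (u : R) : R[i] :=
  Cintegral P setT (fun w => cexp ('i * (u * X w)%:C)).

Definition levy_measure {R : realType}
    (nu : {measure set (measurableTypeR R) -> \bar R}) : Prop :=
  nu [set 0] = 0%E /\
  (\int[nu]_y (Num.min (y ^+ 2) 1)%:E < +oo)%E.

Definition symmetric_measure {R : realType}
    (nu : {measure set (measurableTypeR R) -> \bar R}) : Prop :=
  forall A : set (measurableTypeR R), measurable A ->
    nu [set x | A (- x)] = nu A.

Definition has_lebesgue_density {R : realType}
    (nu : {measure set (measurableTypeR R) -> \bar R})
    (f : measurableTypeR R -> R) : Prop :=
  [/\ measurable_fun setT f,
      (forall x, 0 <= f x) &
      forall A : set (measurableTypeR R), measurable A ->
        nu A = (\int[lebesgue_measure]_(x in A) (f x)%:E)%E].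

Definition class_L {R : realType} (M alpha : R) (f : R -> R) : Prop :=
  forall x : R, 0 < `|x| -> `|x| <= 2 -> f x <= M * `|x| `^ (- (1 + alpha)).

(* The product rule for the full index set suffices: taking some of the A i to
   be setT yields it for every subfamily. *)
Definition mutually_independent {d : measure_display} {T : measurableType d}
    {R : realType} (P : probability T R) {n : nat} (X : 'I_n -> T -> R) : Prop :=
  forall A : 'I_n -> set R, (forall i, measurable (A i)) ->
    P (\bigcap_(i in [set: 'I_n]) (X i @^-1` A i)) =
    (\prod_(i < n) P (X i @^-1` A i))%E.

(* A process is indexed by R for convenience; only the times t >= 0 matter. *)
Definition levy_process {d : measure_display} {T : measurableType d}
    {R : realType} (P : probability T R) (X : R -> {RV P >-> R}) : Prop :=
  [/\ {ae P, forall w, X 0 w = 0},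
      (forall (n : nat) (s : nat -> R), 0 <= s 0%N ->
         {homo s : i j / (i <= j)%N >-> i <= j} ->
         mutually_independent P
           (fun (i : 'I_n) (w : T) => X (s i.+1) w - X (s i) w)),
      (forall s t : R, 0 <= s -> s <= t ->
         forall A : set R, measurable A ->
           P [set w | A (X t w - X s w)] = P [set w | A (X (t - s) w)]) &
      {ae P, forall w,
         (forall t : R, 0 <= t -> X s w @[s --> t^'+] --> X t w) /\
         (forall t : R, 0 < t -> cvg (X s w @[s --> t^'-]))}].

(* X is the Levy process of the compensated jumps of size at most eps of a Levy
   process with Levy measure nu; this is encoded by the characteristic function
   of each X t. *)
Definition small_jumps_process {d : measure_display} {T : measurableType d}
    {R : realType} (P : probability T R)
    (nu : {measure set (measurableTypeR R) -> \bar R}) (eps : R)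
    (X : R -> {RV P >-> R}) : Prop :=
  levy_process P X /\
  forall t u : R, 0 <= t ->
    charfun P (X t) u =
    cexp (t%:C * Cintegral nu [set x : measurableTypeR R | `|x| <= eps]
                   (fun x => cexp ('i * (u * x)%:C) - 1 - 'i * (u * x)%:C)).

Definition E1 {R : realType} (alpha : R) : R :=
  4 * expR (2 + (expR 1)^-1) / (2 - alpha) ^+ 2
  + 4 `^ (1 + alpha) / alpha ^+ 2
  + 2 `^ (alpha + 1) / (9 * alpha * (2 - alpha)).

(* Main.v *)
Require Import Defs.
From HB Require Import structures.
From mathcomp Require Import all_boot all_order all_algebra complex.
From mathcomp Require Import all_classical all_reals all_analysis.
From mathcomp Require Import measurable_realfun.
From mathcomp Require Import ring lra zify.

Import Order.TTheory GRing.Theory Num.Theory.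
Import numFieldNormedType.Exports.

Local Open Scope classical_set_scope.
Local Open Scope ring_scope.

(** Only the identity E cos(u M_t) = exp(t psi(u)) is used, where psi(u) is the
    integral of cos(u x) - 1 over |x| <= eps. Put the mass of nu on each cell of
    a grid of mesh dl = eps / (2 m) at the end of the cell nearest to 0, and let
    T be the transition operator of the random walk on the grid that makes each
    of these jumps with probability (t / n) times its mass. Then cos(u .) is an
    eigenfunction of T, and T^n cos(u .) (0) tends to E cos(u M_t) as n, then m,
    goes to infinity; hence T^n F (0) tends to E F(M_t) for every polynomial F in
    cos(k .). Such an F can be chosen close to the indicator of eps <= |x| <= b.

    For the walk, split T = T0 + T1 into jumps smaller and larger than eps / 2.
    Paths with no large jump are handled by Chernoff's bound, those with two or
    more by the union bound. After exactly one large jump the density bound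
    reduces the probability of exit to E |S|, with S the sum of the small jumps;
    E |S| is bounded by replacing |x| by the Huber function h, for which
    h(x + y) + h(x - y) <= 2 h(x) + 2 h(y), so that E h(S) is at most the sum of
    the E h of the jumps. *)

(** * Transition operators of symmetric random walks *)

Definition jumps {R : realType} (p v : nat -> R) (r : seq nat) (g : R -> R)
    (x : R) : R :=
  \sum_(j <- r) p j * (g (x + v j) + g (x - v j)).

(** [b] is the probability of staying put. The total mass b + 2 sum p is left free, because keeping
    only some of the jumps of a Markov walk leaves a sub-Markov operator. *)
Definition walk {R : realType} (p v : nat -> R) (b : R) (r : seq nat)
    (g : R -> R) (x : R) : R :=
  b * g x + jumps p v r g x.

Lemma jumps_lin (R : realType) (p v : nat -> R) r (g g' : R -> R) a a' x :
  jumps p v r (fun y => a * g y + a' * g' y) x =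
  a * jumps p v r g x + a' * jumps p v r g' x.
Proof.
rewrite /jumps !mulr_sumr -big_split /=; apply: eq_bigr => j _; ring.
Qed.

Lemma walk_lin (R : realType) (p v : nat -> R) (b : R) r (g g' : R -> R) a a' x :
  walk p v b r (fun y => a * g y + a' * g' y) x =
  a * walk p v b r g x + a' * walk p v b r g' x.
Proof. rewrite /walk jumps_lin; ring. Qed.

Lemma jumps_comm (R : realType) (p v : nat -> R) r r' (g : R -> R) x :
  jumps p v r (jumps p v r' g) x = jumps p v r' (jumps p v r g) x.
Proof.
have H s s' : jumps p v s (jumps p v s' g) x =
    \sum_(j <- s) \sum_(k <- s') p j * p k *
      (g (x + v j + v k) + g (x + v j - v k) +
       g (x - v j + v k) + g (x - v j - v k)).
  apply: eq_bigr => j _; rewrite mulrDr !mulr_sumr -big_split /=.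
  by apply: eq_bigr => k _; ring.
rewrite !H exchange_big /=; apply: eq_bigr => j _; apply: eq_bigr => k _.
rewrite (addrAC x (v k) (v j)) (addrAC x (v k) (- v j)).
rewrite (addrAC x (- v k) (v j)) (addrAC x (- v k) (- v j)); ring.
Qed.

(** Both operators are combinations of translations, and translations commute. This allows all
    factors T0 to be gathered when (T0 + T1)^n is expanded. *)
Lemma walk_comm (R : realType) (p v : nat -> R) (b b' : R) r r' (g : R -> R) :
  walk p v b r (walk p v b' r' g) = walk p v b' r' (walk p v b r g).
Proof.
have H c c' s s' x : walk p v c s (walk p v c' s' g) x =
    c * c' * g x + c * jumps p v s' g x + c' * jumps p v s g x
    + jumps p v s (jumps p v s' g) x.
  have -> : walk p v c' s' g = fun y => c' * g y + 1 * jumps p v s' g y.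
    by apply/funext => y; rewrite mul1r.
  by rewrite /walk jumps_lin; ring.
by apply/funext => x; rewrite !H jumps_comm; ring.
Qed.

Lemma walk_cat (R : realType) (p v : nat -> R) (b b' : R) r r' (g : R -> R) x :
  walk p v (b + b') (r ++ r') g x = walk p v b r g x + walk p v b' r' g x.
Proof. by rewrite /walk /jumps big_cat /=; ring. Qed.

Lemma walk_cst (R : realType) (p v : nat -> R) (b : R) r (c x : R) :
  walk p v b r (fun=> c) x = (b + 2 * \sum_(j <- r) p j) * c.
Proof. by rewrite /walk /jumps -mulr_suml; ring. Qed.

Lemma walk_le (R : realType) (p v : nat -> R) (b : R) r (g g' : R -> R) :
  0 <= b -> (forall j, 0 <= p j) -> (forall x, g x <= g' x) ->
  forall x, walk p v b r g x <= walk p v b r g' x.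
Proof.
move=> b0 p0 gg' x; apply: lerD; first exact: ler_wpM2l.
by apply: ler_sum => j _; apply: ler_wpM2l => //; apply: lerD.
Qed.

Lemma iter_walk_le (R : realType) (p v : nat -> R) (b : R) r (g g' : R -> R) n :
  0 <= b -> (forall j, 0 <= p j) -> (forall x, g x <= g' x) ->
  forall x, iter n (walk p v b r) g x <= iter n (walk p v b r) g' x.
Proof. by move=> b0 p0 gg'; elim: n => //= n IH; exact: walk_le. Qed.

Lemma iter_walk_comm (R : realType) (p v : nat -> R) (b b' : R) r r' (g : R -> R) n :
  iter n (walk p v b r) (walk p v b' r' g) =
  walk p v b' r' (iter n (walk p v b r) g).
Proof. by elim: n => //= n ->; rewrite walk_comm. Qed.

Lemma iter_walk_lin (R : realType) (p v : nat -> R) (b : R) r (g g' : R -> R) a a' n x :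
  iter n (walk p v b r) (fun y => a * g y + a' * g' y) x =
  a * iter n (walk p v b r) g x + a' * iter n (walk p v b r) g' x.
Proof.
elim: n x => //= n IH x; rewrite -walk_lin; congr (walk _ _ _ _ _ _).
exact/funext.
Qed.

Lemma iter_walk_cst (R : realType) (p v : nat -> R) (b : R) r (c x : R) n :
  iter n (walk p v b r) (fun=> c) x = (b + 2 * \sum_(j <- r) p j) ^+ n * c.
Proof.
elim: n x => [|n IH] x /=; first by rewrite expr0 mul1r.
rewrite exprS -mulrA -(walk_cst _ _ v _ _ _ x); congr (walk _ _ _ _ _ _).
exact/funext.
Qed.

Lemma iter_walk_cst_le (R : realType) (p v : nat -> R) (b : R) r (c x : R) n :
  0 <= b -> (forall j, 0 <= p j) -> b + 2 * \sum_(j <- r) p j <= 1 -> 0 <= c ->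
  iter n (walk p v b r) (fun=> c) x <= c.
Proof.
move=> b0 p0 m1 c0; rewrite iter_walk_cst ler_piMl// exprn_ile1//.
by rewrite addr_ge0// mulr_ge0// sumr_ge0.
Qed.

(* Expanding (T0 + T1)^n and keeping the terms with at most one factor T1: the
   remainder is the probability of at least two jumps from r1. *)
Lemma walk_two_jumps (R : realType) (p v : nat -> R) (b : R) r0 r1 (g : R -> R) n x :
  0 <= b -> (forall j, 0 <= p j) -> b + 2 * \sum_(j <- r0 ++ r1) p j <= 1 ->
  (forall y, 0 <= g y <= 1) ->
  iter n (walk p v b (r0 ++ r1)) g x <=
    iter n (walk p v b r0) g x
    + n%:R * iter n.-1 (walk p v b r0) (walk p v 0 r1 g) x
    + n%:R * (n%:R - 1) / 2 * (2 * \sum_(j <- r1) p j) ^+ 2.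
Proof.
move=> b0 p0 m1 g01.
set T0 := walk p v b r0; set T1 := walk p v 0 r1; set T := walk p v b _.
set be := 2 * _.
have be0 : 0 <= be by rewrite mulr_ge0// sumr_ge0.
have m0 : b + 2 * \sum_(j <- r0) p j <= 1.
  by apply: le_trans m1; rewrite big_cat/= lerD2l ler_wpM2l// lerDl sumr_ge0.
have TE g' y : T g' y = T0 g' y + T1 g' y by rewrite -walk_cat addr0.
have T01 k y : iter k T0 g y <= 1.
  apply: (@le_trans _ _ (iter k T0 (fun=> 1) y)).
    by apply: iter_walk_le => // z; case/andP: (g01 z).
  exact: iter_walk_cst_le.
(* The first-order version: at each of the k steps, a jump from [r1] costs at most its probability
   [be]. It is applied below to the paths that have already made one such jump. *)
have D k y : iter k T g y <= iter k T0 g y + k%:R * be.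
  elim: k y => [|k IH] y /=; first by rewrite mul0r addr0.
  have -> : k.+1%:R * be = 1 * (k%:R * be) + be by rewrite -natr1; ring.
  rewrite TE [leRHS]addrA; apply: lerD.
    apply: (@le_trans _ _ (T0 (fun z => 1 * iter k T0 g z + (k%:R * be) * 1) y)).
      by rewrite /T0; apply: walk_le => // z; rewrite mul1r mulr1.
    rewrite /T0 walk_lin !mul1r lerD2l walk_cst mulr1 ler_piMr//.
    by rewrite mulr_ge0.
  apply: (@le_trans _ _ (T1 (fun=> 1) y)).
    rewrite /T1; apply: walk_le => // z.
    apply: (@le_trans _ _ (iter k T (fun=> 1) z)).
      by apply: iter_walk_le => // z'; case/andP: (g01 z').
    exact: iter_walk_cst_le.
  by rewrite /T1 walk_cst add0r mulr1.
elim: n x => [|n IH] x /=; first by rewrite !mul0r !addr0.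
set C := _ / 2 * be ^+ 2 in IH.
have C0 : 0 <= C.
  rewrite /C; case: (n) => [|k]; first by rewrite !mul0r.
  rewrite -natr1 addrK; apply: mulr_ge0; last exact: exprn_ge0.
  apply: mulr_ge0; last by rewrite invr_ge0.
  by apply: mulr_ge0 => //; rewrite addr_ge0.
have -> : n.+1%:R * (n.+1%:R - 1) / 2 * be ^+ 2 = C + n%:R * be * be.
  by rewrite /C -natr1; field.
(* One of the n + 1 copies of T1 is commuted to the front, to match T = T0 + T1 there. For n = 0 the
   truncated predecessor has coefficient 0. *)
have -> : n.+1%:R * iter n T0 (T1 g) x =
    n%:R * T0 (iter n.-1 T0 (T1 g)) x + T1 (iter n T0 g) x.
  rewrite [iter n T0 (T1 g)]iter_walk_comm -natr1 mulrDl mul1r; congr (_ + _).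
  case: (n) => [|k]; first by rewrite !mul0r.
  by rewrite -pred_Sn -[T0 _]/(iter k.+1 T0 (T1 g)) [in RHS]iter_walk_comm.
rewrite TE.
have -> : T0 (iter n T0 g) x + (n%:R * T0 (iter n.-1 T0 (T1 g)) x + T1 (iter n T0 g) x)
   + (C + n%:R * be * be) =
   (1 * (1 * T0 (iter n T0 g) x + n%:R * T0 (iter n.-1 T0 (T1 g)) x) + C)
   + (1 * T1 (iter n T0 g) x + n%:R * be * be) by ring.
apply: lerD.
  rewrite /T0 -[in leRHS]walk_lin -/T0.
  apply: (@le_trans _ _ (T0 (fun z =>
      1 * (1 * iter n T0 g z + n%:R * iter n.-1 T0 (T1 g) z) + C * 1) x)).
    by rewrite /T0; apply: walk_le => // z; rewrite !mul1r mulr1.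
  rewrite /T0 (walk_lin _ _ _ _ _ _ (fun=> 1)) lerD2l walk_cst mulr1.
  by rewrite ler_piMr.
apply: (@le_trans _ _ (T1 (fun z => 1 * iter n T0 g z + (n%:R * be) * 1) x)).
  by rewrite /T1; apply: walk_le => // z; rewrite !mul1r mulr1.
by rewrite /T1 walk_lin walk_cst mulr1 add0r.
Qed.

(** * Exponential moments of the walk *)

(** This is 2 cosh x. By the addition formula it is an eigenfunction of every symmetric walk, and it
    controls both tails at once. *)
Definition dcosh {R : realType} (x : R) : R := expR x + expR (- x).

Lemma dcoshD (R : realType) (x y : R) :
  dcosh (x + y) + dcosh (x - y) = dcosh x * dcosh y.
Proof. by rewrite /dcosh !opprD opprK !expRD; ring. Qed.

Lemma walk_dcosh (R : realType) (p v : nat -> R) (b : R) r (s x : R) :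
  walk p v b r (fun y => dcosh (s * y)) x =
  (b + \sum_(j <- r) p j * dcosh (s * v j)) * dcosh (s * x).
Proof.
rewrite /walk /jumps mulrDl mulr_suml; congr (_ + _).
by apply: eq_bigr => j _; rewrite (mulrDr s) (mulrBr s) dcoshD; ring.
Qed.

(** The eigenvalue is b + sum p dcosh <= 1 + sum p (dcosh - 2), by the bound on the total mass, and
    1 + x <= exp x. *)
Lemma iter_walk_dcosh (R : realType) (p v : nat -> R) (b : R) r (s x : R) n :
  0 <= b -> (forall j, 0 <= p j) -> b + 2 * \sum_(j <- r) p j <= 1 ->
  iter n (walk p v b r) (fun y => dcosh (s * y)) x <=
  expR (n%:R * \sum_(j <- r) p j * (dcosh (s * v j) - 2)) * dcosh (s * x).
Proof.
move=> b0 p0 m1.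
have dcosh_ge0 y : 0 <= dcosh y :> R by rewrite addr_ge0// expR_ge0.
set c := b + \sum_(j <- r) p j * dcosh (s * v j).
have -> : iter n (walk p v b r) (fun y => dcosh (s * y)) x =
    c ^+ n * dcosh (s * x).
  elim: n x => [|n IH] x /=; first by rewrite expr0 mul1r.
  (* The summand [0 * 0] is a multiple of the zero function: with it, [walk_lin] gives
     homogeneity. *)
  have -> : iter n (walk p v b r) (fun y => dcosh (s * y)) =
      fun y => c ^+ n * dcosh (s * y) + 0 * 0.
    by apply/funext => y; rewrite mulr0 addr0.
  by rewrite (walk_lin _ _ _ _ _ _ (fun=> 0)) walk_dcosh -/c exprS; ring.
apply: ler_wpM2r => //; rewrite expRM_natl.
have c0 : 0 <= c.
  by rewrite addr_ge0// sumr_ge0// => j _; rewrite mulr_ge0.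
rewrite lerXn2r ?nnegrE ?expR_ge0//.
apply: le_trans (expR_ge1Dx _).
under eq_bigr do rewrite mulrBr; rewrite sumrB -mulr_suml /c; lra.
Qed.

(** * The Huber function, a smooth substitute for the absolute value *)

(** Quadratic up to [a] and affine beyond: jumps below [a] enter through their second moment, larger
    ones through their first, and the distance to |x| is at most a / 2. *)
Definition huber {R : realType} (a x : R) : R :=
  if `|x| <= a then x ^+ 2 / (2 * a) else `|x| - a / 2.

Lemma huber_ge0 (R : realType) (a x : R) : 0 < a -> 0 <= huber a x.
Proof.
move=> a0; rewrite /huber; case: ifPn => [_|]; last by rewrite -ltNge; lra.
by rewrite mulr_ge0 ?sqr_ge0// invr_ge0; lra.
Qed.

Lemma norm_le_huber (R : realType) (a x : R) :
  0 < a -> `|x| <= huber a x + a / 2.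
Proof.
move=> a0; rewrite /huber; case: ifPn => _; last by rewrite subrK.
have -> : x ^+ 2 = `|x| ^+ 2 by rewrite real_normK ?num_real.
rewrite -subr_ge0.
have -> : `|x| ^+ 2 / (2 * a) + a / 2 - `|x| = (`|x| - a) ^+ 2 / (2 * a).
  by field; lra.
by rewrite mulr_ge0 ?sqr_ge0// invr_ge0; lra.
Qed.

(* [huber a] is the infimal convolution of [x^2 / (2 a)] and [|x|]. *)
Lemma huber_le (R : realType) (a x y : R) : 0 < a ->
  huber a x <= y ^+ 2 / (2 * a) + `|x - y|.
Proof.
move=> a0; rewrite /huber; case: ifPn => [xa|_].
  rewrite -subr_ge0.
  have -> : y ^+ 2 / (2 * a) + `|x - y| - x ^+ 2 / (2 * a) =
      (2 * a * `|x - y| + (x - y) ^+ 2 - 2 * (x * (x - y))) / (2 * a).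
    by field; lra.
  apply: mulr_ge0; last by rewrite invr_ge0; lra.
  have := ler_norm (x * (x - y)); rewrite normrM => H.
  have := ler_wpM2r (normr_ge0 (x - y)) xa.
  have := sqr_ge0 (x - y); lra.
have := norm_le_huber _ a y a0; rewrite /huber.
have := ler_normD y (x - y); rewrite subrKC => h1 h2.
suff : `|y| <= y ^+ 2 / (2 * a) + a / 2 by lra.
have -> : y ^+ 2 = `|y| ^+ 2 by rewrite real_normK ?num_real.
rewrite -subr_ge0.
have -> : `|y| ^+ 2 / (2 * a) + a / 2 - `|y| = (`|y| - a) ^+ 2 / (2 * a).
  by field; lra.
by rewrite mulr_ge0 ?sqr_ge0// invr_ge0; lra.
Qed.

(** The minimizer is the projection of [x] onto [-a, a]. *)
Lemma huber_attained (R : realType) (a x : R) : 0 < a ->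
  exists y, huber a x = y ^+ 2 / (2 * a) + `|x - y|.
Proof.
move=> a0; rewrite /huber; case: ifPn => [xa|].
  by exists x; rewrite subrr normr0 addr0.
rewrite -ltNge => xa; have [x0|x0] := leP 0 x.
  exists a; rewrite ger0_norm// in xa *; rewrite ger0_norm ?subr_ge0 ?ltW//.
  by field; lra.
exists (- a); rewrite ltr0_norm// in xa *.
by rewrite ler0_norm; [field; lra|lra].
Qed.

(* The parallelogram law for the square and the triangle inequality for the
   absolute value pass to the infimal convolution. *)
Lemma huber_parallelogram (R : realType) (a x y : R) : 0 < a ->
  huber a (x + y) + huber a (x - y) <= 2 * huber a x + 2 * huber a y.
Proof.
move=> a0.
have [u ->] := huber_attained _ a x a0.
have [w ->] := huber_attained _ a y a0.
have h1 := huber_le _ a (x + y) (u + w) a0.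
have h2 := huber_le _ a (x - y) (u - w) a0.
have h3 := ler_normD (x - u) (y - w).
have h4 := ler_normB (x - u) (y - w).
have e1 : x + y - (u + w) = x - u + (y - w) by ring.
have e2 : x - y - (u - w) = x - u - (y - w) by ring.
rewrite e1 in h1; rewrite e2 in h2.
have e3 : (u + w) ^+ 2 / (2 * a) + (u - w) ^+ 2 / (2 * a) =
  2 * (u ^+ 2 / (2 * a)) + 2 * (w ^+ 2 / (2 * a)) by field; lra.
lra.
Qed.

(** This plays the part of the additivity of variances: by the parallelogram inequality, averaged
    over the two signs, each step adds at most the Huber moment of one jump. *)
Lemma iter_walk_huber (R : realType) (p v : nat -> R) (b : R) r (a x : R) n :
  0 <= b -> (forall j, 0 <= p j) -> b + 2 * \sum_(j <- r) p j <= 1 -> 0 < a ->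
  iter n (walk p v b r) (huber a) x <=
  huber a x + n%:R * (2 * \sum_(j <- r) p j * huber a (v j)).
Proof.
move=> b0 p0 m1 a0; set k := 2 * _.
have k0 : 0 <= k.
  by rewrite mulr_ge0// sumr_ge0// => j _; rewrite mulr_ge0 ?huber_ge0.
elim: n x => [|n IH] x /=; first by rewrite mul0r addr0.
apply: (@le_trans _ _ (walk p v b r
    (fun y => 1 * huber a y + (n%:R * k) * 1) x)).
  by apply: walk_le => // y; rewrite mul1r mulr1.
rewrite walk_lin walk_cst mul1r mulr1.
have -> : huber a x + n.+1%:R * k = huber a x + k + n%:R * k.
  by rewrite -natr1; ring.
apply: lerD; last by rewrite ler_piMr// mulr_ge0.
rewrite /walk /jumps.
have : \sum_(j <- r) p j * (huber a (x + v j) + huber a (x - v j)) <=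
    (2 * \sum_(j <- r) p j) * huber a x + k.
  rewrite /k -mulrA mulr_suml -mulrDr -big_split mulr_sumr /=.
  apply: ler_sum => j _; have := huber_parallelogram _ a x (v j) a0.
  by move/(ler_wpM2l (p0 j)); lra.
have := ler_wpM2r (huber_ge0 _ _ x a0) m1; lra.
Qed.

(** * Exit of the grid walk by one large jump *)

(** [dl] times the indicator is at most the increment of max(., y) over the cell from [j%:R * dl] to
    the next grid point, so the sum telescopes. *)
Lemma sum_ge_grid (R : realType) (dl y : R) k l : 0 <= dl -> (k <= l)%N ->
  dl * \sum_(k <= j < l) (y <= j%:R * dl)%R%:R <=
  Num.max (l%:R * dl) y - Num.max (k%:R * dl) y.
Proof.
move=> d0 kl; rewrite -(telescope_sumr (fun j => Num.max (j%:R * dl) y))//.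
rewrite mulr_sumr; apply: ler_sum => j _; rewrite -natr1 mulrDl mul1r.
by case: (leP y) => h; case: (leP (j%:R * dl + dl) y) => h';
  case: (leP (j%:R * dl) y) => h'' /=; lra.
Qed.

(** Here the increment of min(., y) is taken over the cell that ends at [j%:R * dl], which explains
    the shift by one mesh. *)
Lemma sum_le_grid (R : realType) (dl y : R) k l : 0 <= dl -> (k <= l)%N ->
  dl * \sum_(k <= j < l) (j%:R * dl <= y)%R%:R <=
  Num.min (l%:R * dl - dl) y - Num.min (k%:R * dl - dl) y.
Proof.
move=> d0 kl; rewrite -(telescope_sumr (fun j => Num.min (j%:R * dl - dl) y))//.
rewrite mulr_sumr; apply: ler_sum => j _; rewrite -natr1 mulrDl mul1r addrK.
by case: (leP (j%:R * dl)) => h; case: (leP (j%:R * dl) y) => h';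
  case: (leP (j%:R * dl - dl) y) => h'' /=; lra.
Qed.

(** From x >= 0 an outward jump of size in [eta, 2 eta) reaches 2 eta - r only if it falls in the
    last stretch of length x + r, up to the mesh; an inward jump must overshoot to the other side,
    or start from a large x. Hence the length of the bad set grows like |x|, which is how E |S|
    appears. *)
Lemma sum_exit_grid (R : realType) (dl r x : R) m : 0 <= dl -> 0 <= r ->
  r <= m%:R * dl ->
  let th := 2 * (m%:R * dl) - r in
  dl * \sum_(m <= j < 2 * m)
    ((th <= `|x + j%:R * dl|)%R%:R + (th <= `|x - j%:R * dl|)%R%:R) <=
  `|x| + 2 * r + 2 * dl.
Proof.
move=> d0 r0 rm; cbv zeta; set th := 2 * _ - r.
wlog x0 : x / 0 <= x => [H|].
  have [x0|x0] := leP 0 x; first exact: H.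
  have := H (- x); rewrite oppr_ge0 ltW// normrN => /(_ isT).
  under eq_bigr => j _.
    rewrite (_ : - x + j%:R * dl = - (x - j%:R * dl)); last by ring.
    rewrite (_ : - x - j%:R * dl = - (x + j%:R * dl)); last by ring.
    rewrite !normrN addrC; over.
  by [].
have mm : (m <= 2 * m)%N by lia.
rewrite ger0_norm//.
have h1 := sum_ge_grid _ dl (th - x) m (2 * m) d0 mm.
have h2 := sum_le_grid _ dl (x - th) m (2 * m) d0 mm.
have h3 := sum_ge_grid _ dl (th + x) m (2 * m) d0 mm.
apply: (@le_trans _ _ (dl * (\sum_(m <= j < 2 * m) (th - x <= j%:R * dl)%R%:R +
    \sum_(m <= j < 2 * m) (j%:R * dl <= x - th)%R%:R +
    \sum_(m <= j < 2 * m) (th + x <= j%:R * dl)%R%:R))).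
  rewrite ler_wpM2l// -!big_split; apply: ler_sum => j _ /=.
  have jd : 0 <= j%:R * dl by rewrite mulr_ge0.
  rewrite (ger0_norm (_ : 0 <= x + j%:R * dl)); last by lra.
  rewrite -addrA; apply: lerD.
    by have -> : (th <= x + j%:R * dl) = (th - x <= j%:R * dl) by apply/idP/idP; lra.
  rewrite ler_normr.
  have -> : (th <= x - j%:R * dl) = (j%:R * dl <= x - th).
    by apply/idP/idP; lra.
  have -> : (th <= - (x - j%:R * dl)) = (th + x <= j%:R * dl).
    by apply/idP/idP; lra.
  by case: (_ <= x - th); case: (_ + x <= _); rewrite /=; lra.
rewrite !mulrDr; move: h1 h2 h3; rewrite natrM.
set S1 := dl * _; set S2 := dl * _; set S3 := dl * _; move: S1 S2 S3 => S1 S2 S3.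
set e := m%:R * dl in rm th *; rewrite -mulrA -/e /th.
move=> h1 h2 h3.
have {h3} h3 : S3 <= r.
  apply: le_trans h3 _; case: (leP (2 * e) (2 * e - r + x)) => g5;
  case: (leP e (2 * e - r + x)) => g6; lra.
(* The bound x + r serves when [S2] vanishes; for the large x at which it does not, the full length
   [e] is the better bound. *)
have h1' : S1 <= e /\ S1 <= x + r.
  split; apply: le_trans h1 _; case: (leP (2 * e) (2 * e - r - x)) => g1;
  case: (leP e (2 * e - r - x)) => g2; lra.
have h2' : S2 <= Num.max 0 (x - 3 * e + r + dl).
  apply: le_trans h2 _; rewrite le_max; apply/orP.
  case: (leP (2 * e - dl) (x - (2 * e - r))) => g3;
  case: (leP (e - dl) (x - (2 * e - r))) => g4; first by right; lra.
  - by left; lra.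
  - by right; lra.
  - by left; lra.
move: h1' h2' => [h1a h1b]; clear h1 h2.
by case: (leP 0 (x - 3 * e + r + dl)) => g; lra.
Qed.

(* With [p j = t q j / n] and [v j = j dl], [walk] is the transition operator of
   one step of a random walk whose n-th step approximates the compound Poisson
   process of intensity [\sum_j q j (\d_(j dl) + \d_(- j dl))] at time t. The
   three terms correspond to zero, one and at least two jumps of index >= m. *)
Lemma walk_tail (R : realType) (q : nat -> R) (dl t c r s a : R) (m n : nat) :
  (forall j, 0 <= q j) -> 0 <= dl -> 0 <= t -> 0 <= c -> 0 <= r ->
  r <= m%:R * dl -> 0 <= s -> 0 < a -> (0 < m)%N -> (0 < n)%N ->
  (forall j, (m <= j < 2 * m)%N -> q j <= c * dl) ->
  t * (2 * \sum_(1 <= j < 2 * m) q j) <= n%:R ->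
  let p j := t / n%:R * q j in
  let b := 1 - 2 * \sum_(1 <= j < 2 * m) p j in
  let th := 2 * (m%:R * dl) - r in
  iter n (walk p (fun j => j%:R * dl) b (index_iota 1 (2 * m)))
    (fun x => (th <= `|x|)%R%:R) 0 <=
  2 * expR (t * \sum_(1 <= j < m) q j * (dcosh (s * (j%:R * dl)) - 2) - s * th)
  + t * c * (t * (2 * \sum_(1 <= j < m) q j * huber a (j%:R * dl))
             + a / 2 + 2 * r + 2 * dl)
  + 2 * (t * c * (m%:R * dl)) ^+ 2.
Proof.
move=> q0 d0 t0 c0 r0 rm s0 a0 m_gt0 n_gt0 qc tl; cbv zeta.
set p := fun j => t / n%:R * q j; set b := 1 - _; set th := 2 * _ - r.
have n0 : 0 < n%:R :> R by rewrite ltr0n.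
have p0 j : 0 <= p j by rewrite mulr_ge0// divr_ge0.
have b0 : 0 <= b.
  rewrite /b -mulr_sumr subr_ge0.
  have -> : 2 * (t / n%:R * \sum_(1 <= j < 2 * m) q j) =
     t * (2 * \sum_(1 <= j < 2 * m) q j) / n%:R by field; lra.
  by rewrite ler_pdivrMr// mul1r.
set v := fun j => j%:R * dl; set g := fun x => _.
have idx : index_iota 1 (2 * m) = index_iota 1 m ++ index_iota m (2 * m).
  rewrite /index_iota (_ : 2 * m - 1 = (m - 1) + (2 * m - m))%N; last first.
    by clear -m_gt0; lia.
  by rewrite iotaD subnKC.
have m1 : b + 2 * \sum_(j <- index_iota 1 m ++ index_iota m (2 * m)) p j <= 1.
  by rewrite -idx subrK.
have m0 : b + 2 * \sum_(1 <= j < m) p j <= 1.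
  by apply: le_trans m1; rewrite big_cat/= lerD2l ler_wpM2l// lerDl sumr_ge0.
rewrite idx.
apply: le_trans (walk_two_jumps _ p v b _ _ g n 0 b0 p0 m1 _) _.
  by move=> y; rewrite /g ler0n lern1 leq_b1.
apply: lerD; first apply: lerD.
(* Chernoff: the indicator of th <= |x| is at most exp(- s th) dcosh(s x). *)
- apply: (@le_trans _ _ (iter n (walk p v b (index_iota 1 m))
     (fun x => expR (- (s * th)) * dcosh (s * x) + 0 * 0) 0)).
    apply: iter_walk_le => // x; rewrite mulr0 addr0 /g.
    case: (leP th) => xth /=; last by rewrite mulr_ge0 ?expR_ge0 ?addr_ge0 ?expR_ge0.
    rewrite /dcosh mulrDr -!expRD.
    have [x0|x0] := leP 0 x.
      apply: ler_wpDr; first exact: expR_ge0.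
      rewrite ger0_norm// in xth.
      by rewrite -[leLHS]expR0 ler_expR addrC -mulrBr mulr_ge0// subr_ge0.
    apply: ler_wpDl; first exact: expR_ge0.
    rewrite ltr0_norm// in xth.
    rewrite -[leLHS]expR0 ler_expR addrC -mulrN -mulrBr mulr_ge0//; lra.
  rewrite (iter_walk_lin _ _ _ _ _ _ (fun=> 0)) mul0r addr0.
  have := iter_walk_dcosh _ p v b (index_iota 1 m) s 0 n b0 p0 m0.
  have d0E : dcosh 0 = 2 :> R by rewrite /dcosh oppr0 expR0.
  rewrite mulr0 d0E => H.
  have -> : t * \sum_(1 <= j < m) q j * (dcosh (s * (j%:R * dl)) - 2) - s * th =
     n%:R * (\sum_(1 <= j < m) p j * (dcosh (s * v j) - 2)) + (- (s * th)).
    rewrite !mulr_sumr; congr (_ - _); apply: eq_bigr => j _.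
    by rewrite /p /v; field; lra.
  by rewrite expRD; have := ler_wpM2l (expR_ge0 (- (s * th))) H; lra.
- set d := a / 2 + 2 * r + 2 * dl.
  have d_ge0 : 0 <= d by rewrite /d; lra.
  have tc : 0 <= t / n%:R * c by rewrite mulr_ge0// divr_ge0// ltW.
  (* The rates of large jumps are at most [c] per unit length, so [sum_exit_grid] applies; then |x|
     is replaced by its Huber function at the cost of a / 2. *)
  have T1g x : walk p v 0 (index_iota m (2 * m)) g x <=
      (t / n%:R * c) * huber a x + (t / n%:R * c * d) * 1.
    rewrite mulr1 -mulrDr.
    apply: (@le_trans _ _ (t / n%:R * c * (`|x| + 2 * r + 2 * dl))); last first.
      by apply: ler_wpM2l => //; have := norm_le_huber _ a x a0; rewrite /d; lra.
    have := ler_wpM2l tc (sum_exit_grid _ dl r x m d0 r0 rm).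
    apply: le_trans; rewrite /walk mul0r add0r /jumps.
    rewrite [leRHS]mulrA mulr_sumr; apply: ler_sum_nat => j jm.
    apply: ler_wpM2r; first by rewrite addr_ge0// ler0n.
    have tn : 0 <= t / n%:R by rewrite divr_ge0// ltW.
    by have := ler_wpM2l tn (qc j jm); rewrite mulrA.
  apply: (@le_trans _ _ (n%:R * iter n.-1 (walk p v b (index_iota 1 m))
      (fun x => (t / n%:R * c) * huber a x + (t / n%:R * c * d) * 1) 0)).
    by apply: ler_wpM2l; [exact: ltW|exact: iter_walk_le].
  rewrite (iter_walk_lin _ _ _ _ _ _ (fun=> 1)).
  have h1 := iter_walk_cst_le _ p v b (index_iota 1 m) 1 0 n.-1 b0 p0 m0 ler01.
  have h2 := iter_walk_huber _ p v b (index_iota 1 m) a 0 n.-1 b0 p0 m0 a0.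
  have h3 : huber a (0 : R) = 0 by rewrite /huber normr0 ltW// expr0n mul0r.
  set K := t * (2 * _).
  have h4 : iter n.-1 (walk p v b (index_iota 1 m)) (huber a) 0 <= K.
    apply: le_trans h2 _; rewrite h3 add0r.
    apply: (@le_trans _ _ (n%:R * (2 * \sum_(1 <= j < m) p j * huber a (v j)))).
      apply: ler_wpM2r; last by rewrite ler_nat leq_pred.
      rewrite mulr_ge0// sumr_ge0// => j _; rewrite mulr_ge0//; exact: huber_ge0.
    rewrite /K !mulr_sumr; apply: ler_sum => j _.
    by rewrite le_eqVlt; apply/orP; left; apply/eqP; rewrite /p /v; field; lra.
  have -> : t * c * (K + a / 2 + 2 * r + 2 * dl) =
     n%:R * (t / n%:R * c * K + t / n%:R * c * d * 1) by rewrite /d; field; lra.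
  apply: ler_wpM2l; first exact: ltW.
  apply: lerD; first exact: ler_wpM2l.
  by apply: ler_wpM2l => //; rewrite mulr_ge0.
set B := 2 * _.
have B0 : 0 <= B by rewrite mulr_ge0// sumr_ge0.
(* n B is the expected number of large jumps in n steps, and n (n - 1) / 2 B^2 <= (n B)^2 / 2 gives
   the last term. *)
have Bc : n%:R * B <= 2 * (t * c * (m%:R * dl)).
  have -> : n%:R * B = 2 * (t * \sum_(m <= j < 2 * m) q j).
    by rewrite /B -mulr_sumr; field; lra.
  apply: ler_wpM2l => //; rewrite -mulrA; apply: ler_wpM2l => //.
  have -> : c * (m%:R * dl) = \sum_(m <= j < 2 * m) (c * dl).
    by rewrite sumr_const_nat mul2n -addnn addnK -mulr_natr; ring.
  by apply: ler_sum_nat => j; exact: qc.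
have nB : 0 <= n%:R * B by rewrite mulr_ge0// ltW.
have : (n%:R * B) ^+ 2 <= (2 * (t * c * (m%:R * dl))) ^+ 2.
  by rewrite lerXn2r ?nnegrE// (le_trans nB).
have : 0 <= n%:R * B ^+ 2 by rewrite mulr_ge0 ?sqr_ge0// ltW.
have -> : n%:R * (n%:R - 1) / 2 * B ^+ 2 = ((n%:R * B) ^+ 2 - n%:R * B ^+ 2) / 2.
  by field.
rewrite (exprMn 2); lra.
Qed.

(** * Comparison of sums over the grid with integrals of the stable density *)

Lemma MVT_closed (R : realType) (f df : R -> R) (a b : R) : a <= b ->
  (forall x, a <= x <= b -> is_derive x 1 f (df x)) ->
  exists2 c, a <= c <= b & f b - f a = df c * (b - a).
Proof.
move=> ab fdf.
have [||c] := @MVT_segment R f df a b ab.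
- move=> x; rewrite in_itv/= => /andP[/ltW ax /ltW xb].
  by apply: fdf; rewrite ax.
- apply: derivable_within_continuous => x; rewrite in_itv/= => xab.
  by have [] := fdf x xab.
by rewrite in_itv/= => cab e; exists c.
Qed.

Lemma decreasing_le_primitive (R : realType) (F f : R -> R) (a b : R) : a <= b ->
  (forall x, a <= x <= b -> is_derive x 1 F (f x)) ->
  (forall x, a <= x <= b -> f b <= f x) ->
  (b - a) * f b <= F b - F a.
Proof.
move=> ab Ff fb; have [c cab ->] := MVT_closed _ F f a b ab Ff.
by rewrite mulrC ler_wpM2r ?subr_ge0// fb.
Qed.

(** (2 cosh x - 2) / x^2 is nondecreasing for x > 0: the numerator is (2 sinh(x / 2))^2, and sinh is
    convex on the half-line with sinh 0 = 0. The convexity is used through the mean slopes on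
    [0, x / 2] and [x / 2, y / 2]. *)
Lemma dcosh_quadratic (R : realType) (x y : R) : 0 <= x -> x <= y -> 0 < y ->
  dcosh x - 2 <= (x / y) ^+ 2 * (dcosh y - 2).
Proof.
move=> x0 xy y0.
pose sh z : R := expR z - expR (- z).
have shE z : dcosh z - 2 = sh (z / 2) ^+ 2.
  rewrite /sh sqrrB -expRD -!expRM_natl !mulrN subrr expR0 mulrCA divff ?mulr1.
    by rewrite /dcosh; ring.
  by [].
have dsh (z : R) : is_derive z (1 : R) sh (dcosh z).
  rewrite /sh /dcosh; apply: is_derive_eq.
  by rewrite /GRing.scale/=; ring.
have sh0 : sh 0 = 0 by rewrite /sh oppr0 subrr.
have dcosh_le (u v : R) : 0 <= u -> u <= v -> dcosh u <= dcosh v.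
  move=> u0 uv; rewrite -subr_ge0.
  have -> : dcosh v - dcosh u = (expR v - expR u) * (1 - expR (- u - v)).
    have hu := expRxMexpNx_1 u; have hv := expRxMexpNx_1 v.
    rewrite /dcosh expRD; move: hu hv.
    move: (expR u) (expR v) (expR (- u)) (expR (- v)) => U V U' V' hu hv.
    have -> : (V - U) * (1 - U' * V') = V - U - (V * V') * U' + (U * U') * V' by ring.
    by rewrite hu hv; ring.
  by rewrite mulr_ge0// subr_ge0 ?ler_expR// expR_le1; lra.
have x2 : 0 <= x / 2 by lra.
have xy2 : x / 2 <= y / 2 by lra.
have [c1 /andP[c10 c11] e1] :=
  MVT_closed _ sh dcosh 0 (x / 2) x2 (fun z _ => dsh z).
have [c2 /andP[c20 c21] e2] :=
  MVT_closed _ sh dcosh (x / 2) (y / 2) xy2 (fun z _ => dsh z).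
have c12 := dcosh_le c1 c2 c10 (le_trans c11 c20).
rewrite !shE -exprMn sh0 !subr0 in e1 *.
have d0 : 0 <= dcosh c1 by rewrite addr_ge0 ?expR_ge0.
rewrite lerXn2r ?nnegrE//.
- by rewrite e1 mulr_ge0//; lra.
- rewrite mulr_ge0 ?divr_ge0//; first by lra.
  have -> : sh (y / 2) = dcosh c2 * (y / 2 - x / 2) + dcosh c1 * (x / 2) by lra.
  by rewrite addr_ge0// mulr_ge0; lra.
- have -> : sh (y / 2) = dcosh c2 * (y / 2 - x / 2) + dcosh c1 * (x / 2) by lra.
  rewrite e1 -subr_ge0.
  have -> : x / y * (dcosh c2 * (y / 2 - x / 2) + dcosh c1 * (x / 2))
      - dcosh c1 * (x / 2) =
    x / y * ((y - x) / 2) * (dcosh c2 - dcosh c1) by field; lra.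
  by rewrite !mulr_ge0 ?invr_ge0//; lra.
Qed.

Lemma sum_grid_le_primitive (R : realType) (F f : R -> R) (dl : R) l m :
  (l <= m)%N ->
  (forall j, (l <= j < m)%N ->
    dl * f (j.+1%:R * dl) <= F (j.+1%:R * dl) - F (j%:R * dl)) ->
  \sum_(l.+1 <= j < m.+1) dl * f (j%:R * dl) <= F (m%:R * dl) - F (l%:R * dl).
Proof.
move=> lm h; rewrite -(telescope_sumr (fun j => F (j%:R * dl)))// big_add1.
exact: ler_sum_nat.
Qed.

Lemma powR_increment (R : realType) (r b c : R) : 0 < r <= 1 -> 0 <= c <= b ->
  (b - c) * b `^ (r - 1) <= (b `^ r - c `^ r) / r.
Proof.
move=> /andP[r0 r1] /andP[c0 cb].
(* The power need not be differentiable at 0, so c = 0 is treated apart: the claim becomes b^r <=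
   b^r / r. *)
move: c0 cb; rewrite le_eqVlt => /predU1P[<-|c0] cb.
  rewrite subr0 powR0 ?gt_eqF// subr0.
  have [b0|b0] := leP b 0.
    have -> : b = 0 by apply/eqP; rewrite eq_le b0 cb.
    by rewrite mul0r divr_ge0 ?powR_ge0// ltW.
  rewrite (mulr_powRB1 (ltW b0) r0) -[leLHS]mulr1 ler_wpM2l ?powR_ge0//.
  by rewrite invf_ge1.
have -> : (b `^ r - c `^ r) / r = r^-1 * b `^ r - r^-1 * c `^ r by ring.
apply: (decreasing_le_primitive _ (fun x => r^-1 * x `^ r)
  (fun x => x `^ (r - 1))) => //.
  move=> x /andP[cx _].
  have x0 := lt_le_trans c0 cx.
  have := is_deriveZ r^-1 (is_derive1_powR r x0).
  by rewrite /GRing.scale/= mulrA mulVf ?mul1r// gt_eqF.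
move=> x /andP[cx xb].
have x0 := lt_le_trans c0 cx; have b0 := lt_le_trans x0 xb.
rewrite -opprB !powRN lef_pV2 ?posrE ?powR_gt0//.
by apply: ge0_ler_powR => //; rewrite ?nnegrE; lra.
Qed.

(** The truncated second moment of the stable density, as x^2 x^(-(1 + al)) = x^(1 - al). This
    function is nonincreasing and the sum takes right end points, so it lies below the integral from
    0. *)
Lemma sum_powR_grid (R : realType) (al dl : R) m : 1 <= al < 2 -> 0 <= dl ->
  \sum_(1 <= j < m.+1) dl * (j%:R * dl) `^ (1 - al) <=
  (m%:R * dl) `^ (2 - al) / (2 - al).
Proof.
move=> /andP[al1 al2] dl0.
have := sum_grid_le_primitive _ (fun x => x `^ (2 - al) / (2 - al))
  (fun x => x `^ (1 - al)) dl 0 m (leq0n _).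
rewrite mul0r powR0 ?subr_eq0 ?gt_eqF// mul0r subr0; apply => j _.
rewrite -mulrBl.
have := powR_increment _ (2 - al) (j.+1%:R * dl) (j%:R * dl).
rewrite (_ : j.+1%:R * dl - j%:R * dl = dl); last by rewrite -natr1; ring.
rewrite (_ : 2 - al - 1 = 1 - al); last by ring.
apply; first by lra.
by rewrite mulr_ge0//= ler_wpM2r// ler_nat.
Qed.

(** After scaling by b / x >= 1, the exponent 1 + al >= 2 may be lowered to 2, and (x - a / 2) / x^2
    decreases from x = a on. *)
Lemma huber_tail_decreasing (R : realType) (al a x b : R) :
  1 <= al -> 0 < a -> a <= x -> x <= b ->
  (b - a / 2) * b `^ (- (1 + al)) <= (x - a / 2) * x `^ (- (1 + al)).
Proof.
move=> al1 a0 ax xb.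
have x0 := lt_le_trans a0 ax; have b0 := lt_le_trans x0 xb.
have {1}-> : b = x * (b / x) by field; lra.
have u1 : 1 <= b / x by rewrite ler_pdivlMr// mul1r.
have -> : b `^ (- (1 + al)) = x `^ (- (1 + al)) * (b / x) `^ (- (1 + al)).
  rewrite -powRM ?ltW//; first by congr powR; field; lra.
  by rewrite divr_gt0.
have : (b / x) `^ (- (1 + al)) <= (b / x) `^ (- 2%:R) by apply: ler_powR => //; lra.
rewrite (powR_invn 2 (le_trans ler01 u1)) => h.
have xp := powR_ge0 x (- (1 + al)).
apply: (@le_trans _ _ ((x * (b / x) - a / 2) * (x `^ (- (1 + al)) * (b / x) ^- 2))).
  rewrite ler_wpM2l// ?ler_wpM2l//.
  have -> : x * (b / x) = b by field; lra.
  lra.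
rewrite mulrCA mulrC ler_wpM2r// -subr_ge0.
have -> : x - a / 2 - (x * (b / x) - a / 2) * (b / x) ^- 2 =
  (b - x) * (x * (b - a) + b * (x - a)) / (2 * b ^+ 2).
  by field; rewrite !gt_eqF.
apply: divr_ge0; last by apply: mulr_ge0 => //; exact: sqr_ge0.
apply: mulr_ge0; first by lra.
by rewrite addr_ge0// mulr_ge0; lra.
Qed.

(** The sum is split at [k], where the grid meets the kink [a] exactly: the quadratic part is a
    second moment, the affine part has the primitive [F]. *)
Lemma sum_huber_grid (R : realType) (al dl : R) (F : R -> R) m k :
  1 <= al < 2 -> 0 < dl -> (0 < k <= m)%N ->
  let a := k%:R * dl in
  (forall x, a <= x -> is_derive x 1 F ((x - a / 2) * x `^ (- (1 + al)))) ->
  \sum_(1 <= j < m.+1) dl * (huber a (j%:R * dl) * (j%:R * dl) `^ (- (1 + al)))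
  <= a `^ (1 - al) / (2 * (2 - al)) + (F (m%:R * dl) - F a).
Proof.
move=> al12 dl0 /andP[k0 km]; cbv zeta; set a := k%:R * dl => dF.
have a0 : 0 < a by rewrite mulr_gt0// ltr0n.
rewrite (@big_cat_nat _ _ _ k.+1)//=; apply: lerD.
  have -> : a `^ (1 - al) / (2 * (2 - al)) =
      (2 * a)^-1 * (a `^ (2 - al) / (2 - al)).
    rewrite (_ : 2 - al = 1 + (1 - al)); last by ring.
    rewrite [a `^ (1 + (1 - al))]powRD ?(gt_eqF a0) ?implybT// powRr1 ?ltW//.
    by field; lra.
  have := sum_powR_grid _ al dl k al12 (ltW dl0).
  have i0 : 0 <= (2 * a)^-1 by rewrite invr_ge0; lra.
  move/(ler_wpM2l i0) => h; apply: le_trans h; rewrite mulr_sumr.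
  apply: ler_sum_nat => j /andP[j1 jk].
  have j0 : 0 < j%:R * dl by rewrite mulr_gt0// ltr0n.
  have ja : j%:R * dl <= a by rewrite (ler_wpM2r (ltW dl0))// ler_nat.
  rewrite /huber gtr0_norm// ja.
  rewrite (_ : 1 - al = 2 + - (1 + al)); last by ring.
  rewrite powRD ?(gt_eqF j0) ?implybT// (powR_mulrn 2 (ltW j0)).
  by rewrite le_eqVlt; apply/orP; left; apply/eqP; field; lra.
have h := sum_grid_le_primitive _ F
  (fun x => huber a x * x `^ (- (1 + al))) dl k m km.
apply: h => j /andP[kj jm].
have cj : a <= j%:R * dl by rewrite (ler_wpM2r (ltW dl0))// ler_nat.
have jj : j.+1%:R * dl = j%:R * dl + dl by rewrite -natr1 mulrDl mul1r.
have := decreasing_le_primitive _ F (fun x => (x - a / 2) * x `^ (- (1 + al)))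
  (j%:R * dl) (j.+1%:R * dl).
rewrite (_ : j.+1%:R * dl - j%:R * dl = dl); last by rewrite jj; ring.
move=> H.
rewrite /huber ger0_norm; last by rewrite jj; lra.
rewrite (_ : (j.+1%:R * dl <= a) = false); last first.
  by apply/negbTE; rewrite -ltNge jj; lra.
apply: H; first by rewrite jj; lra.
  by move=> x /andP[jx _]; apply: dF; exact: le_trans jx.
by move=> x /andP[jx xj]; apply: huber_tail_decreasing => //;
  [lra|exact: le_trans jx].
Qed.

(** The constant is the integral over the whole half-line: 1 / (2 (2 - al)) + 1 / (al - 1) - 1 / (2
    al) = 1 / (al (2 - al) (al - 1)). *)
Lemma sum_huber_grid_gt1 (R : realType) (al dl : R) m k :
  1 < al < 2 -> 0 < dl -> (0 < k <= m)%N ->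
  let a := k%:R * dl in
  \sum_(1 <= j < m.+1) dl * (huber a (j%:R * dl) * (j%:R * dl) `^ (- (1 + al)))
  <= a `^ (1 - al) / (al * (2 - al) * (al - 1)).
Proof.
move=> /andP[al1 al2] dl0 km; cbv zeta; set a := k%:R * dl.
have a0 : 0 < a by rewrite mulr_gt0// ltr0n; case/andP: km.
pose F x : R := (1 - al)^-1 * x `^ (1 - al) + (a / (2 * al)) * x `^ (- al).
have al12 : 1 <= al < 2 by lra.
apply: le_trans (sum_huber_grid _ al dl F m k al12 dl0 km _) _.
  rewrite -/a => x ax; have x0 := lt_le_trans a0 ax.
  have h1 := is_deriveZ (1 - al)^-1 (is_derive1_powR (1 - al) x0).
  have h2 := is_deriveZ (a / (2 * al)) (is_derive1_powR (- al) x0).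
  have := is_deriveD h1 h2; rewrite /GRing.scale/=.
  move/is_derive_eq; apply.
  rewrite (_ : 1 - al - 1 = - al); last by ring.
  rewrite (_ : - al - 1 = - (1 + al)); last by ring.
  rewrite (_ : x `^ (- al) = x * x `^ (- (1 + al))).
    by field; lra.
  rewrite -{2}(powRr1 (ltW x0)) -powRD ?(gt_eqF x0) ?implybT//.
  by congr powR; ring.
rewrite -/a; set b := m%:R * dl.
have ab : a <= b by rewrite (ler_wpM2r (ltW dl0))// ler_nat; case/andP: km.
have b0 := lt_le_trans a0 ab.
have E x : 0 < x -> x `^ (1 - al) = x * x `^ (- al).
  by move=> x0; rewrite -{2}(powRr1 (ltW x0)) -powRD ?(gt_eqF x0) ?implybT.
have Fb : F b <= 0.
  rewrite /F E//.
  have -> : (1 - al)^-1 * (b * b `^ (- al)) + a / (2 * al) * b `^ (- al) =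
    - ((2 * al * b - (al - 1) * a) / (2 * al * (al - 1)) * b `^ (- al)).
    by field; lra.
  rewrite oppr_le0 mulr_ge0 ?powR_ge0// divr_ge0 ?mulr_ge0//; try lra.
  have : (al - 1) * a <= 2 * al * b; last by lra.
  by apply: ler_pM => //; lra.
suff -> : a `^ (1 - al) / (al * (2 - al) * (al - 1)) =
   a `^ (1 - al) / (2 * (2 - al)) - F a by lra.
by rewrite /F E//; field; lra.
Qed.

(** For exponent 1 the first moment of the tail diverges logarithmically, so the upper end
    [m%:R * dl] stays in the bound. *)
Lemma sum_huber_grid_1 (R : realType) (dl : R) m k :
  0 < dl -> (0 < k <= m)%N ->
  let a := k%:R * dl in
  \sum_(1 <= j < m.+1) dl * (huber a (j%:R * dl) * (j%:R * dl) `^ (- (1 + 1)))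
  <= 1 / 2 + ln (m%:R * dl / a).
Proof.
move=> dl0 km; cbv zeta; set a := k%:R * dl.
have a0 : 0 < a by rewrite mulr_gt0// ltr0n; case/andP: km.
pose F x : R := ln x + (a / 2) * x `^ (- 1).
have al12 : 1 <= (1 : R) < 2 by lra.
apply: le_trans (sum_huber_grid _ 1 dl F m k al12 dl0 km _) _.
  rewrite -/a => x ax; have x0 := lt_le_trans a0 ax.
  have h1 := is_derive1_ln x0.
  have h2 := is_deriveZ (a / 2) (is_derive1_powR (- 1) x0).
  have := is_deriveD h1 h2; rewrite /GRing.scale/=.
  move/is_derive_eq; apply.
  rewrite (_ : -1 - 1 = - 2%:R); last by ring.
  rewrite (_ : - (1 + 1) = - 2%:R); last by ring.
  by rewrite powR_invn ?ltW//; field; lra.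
rewrite -/a; set b := m%:R * dl.
have ab : a <= b by rewrite (ler_wpM2r (ltW dl0))// ler_nat; case/andP: km.
have b0 := lt_le_trans a0 ab.
rewrite /F (powR_inv1 (ltW a0)) (powR_inv1 (ltW b0)) subrr powRr0 ln_div ?posrE//.
have : a / 2 / b <= a / 2 / a.
  by rewrite ler_wpM2l ?lef_pV2 ?posrE//; lra.
have -> : a / 2 / a = 1 / 2 by field; lra.
have -> : 1 / (2 * (2 - 1)) = 1 / 2 :> R by field.
lra.
Qed.

Lemma dcosh_ge2 (R : realType) (x : R) : 2 <= dcosh x.
Proof.
by have := expR_ge1Dx x; have := expR_ge1Dx (- x); rewrite /dcosh; lra.
Qed.

(** By [dcosh_quadratic] each term is compared with the value at the end point [m%:R * dl], which
    leaves a truncated second moment. *)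
Lemma sum_dcosh_grid (R : realType) (q : nat -> R) (al M dl s : R) m :
  1 <= al < 2 -> 0 < dl -> (0 < m)%N -> 0 < s -> 0 <= M ->
  (forall j, 0 <= q j) ->
  (forall j, (0 < j < m)%N -> q j <= M * dl * (j%:R * dl) `^ (- (1 + al))) ->
  \sum_(1 <= j < m) q j * (dcosh (s * (j%:R * dl)) - 2) <=
  M * (m%:R * dl) `^ (- al) / (2 - al) * (dcosh (s * (m%:R * dl)) - 2).
Proof.
move=> al12 dl0 m0 s0 M0 q0 qM; set b := m%:R * dl; set D := dcosh (s * b) - 2.
have b0 : 0 < b by rewrite mulr_gt0// ltr0n.
have D0 : 0 <= D by rewrite subr_ge0 dcosh_ge2.
apply: (@le_trans _ _ (M * (D / b ^+ 2) *
    \sum_(1 <= j < m.+1) dl * (j%:R * dl) `^ (1 - al))); last first.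
  have := sum_powR_grid _ al dl m al12 (ltW dl0).
  have C0 : 0 <= M * (D / b ^+ 2) by rewrite mulr_ge0// divr_ge0// sqr_ge0.
  move=> /(ler_wpM2l C0) h; apply: le_trans h _; rewrite -/b.
  rewrite powRD ?(gt_eqF b0) ?implybT//.
  rewrite (powR_mulrn 2 (ltW b0)).
  by rewrite le_eqVlt; apply/orP; left; apply/eqP; field; lra.
rewrite mulr_sumr big_nat_recr//=; apply: ler_wpDr.
  apply: mulr_ge0; last by rewrite mulr_ge0 ?powR_ge0 ?(ltW dl0).
  by rewrite mulr_ge0// divr_ge0// sqr_ge0.
apply: ler_sum_nat => j /andP[j1 jm].
have j0 : 0 < j%:R * dl by rewrite mulr_gt0// ltr0n.
have jb : j%:R * dl <= b by rewrite (ler_wpM2r (ltW dl0))// ler_nat ltnW.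
have sj : 0 < s * (j%:R * dl) by exact: mulr_gt0.
have sjb : s * (j%:R * dl) <= s * b by rewrite (ler_wpM2l (ltW s0)).
have h1 := dcosh_quadratic _ _ _ (ltW sj) sjb (lt_le_trans sj sjb).
apply: le_trans (ler_wpM2l (q0 j) h1) _; rewrite -/D.
have h2 : q j <= M * dl * (j%:R * dl) `^ (- (1 + al)) by rewrite qM// j1.
have C0 : 0 <= (s * (j%:R * dl) / (s * b)) ^+ 2 * D by rewrite mulr_ge0// sqr_ge0.
apply: le_trans (ler_wpM2r C0 h2) _.
rewrite (_ : 1 - al = 2%:R + - (1 + al)); last by ring.
rewrite powRD ?(gt_eqF j0) ?implybT// (powR_mulrn 2 (ltW j0)).
by rewrite le_eqVlt; apply/orP; left; apply/eqP; field; rewrite !gt_eqF.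
Qed.

(** * The tail of the walk under the stable rate bound, and its constants *)

(** [walk_tail] with its parameters chosen: s = ln(4 / w) / eta makes the Chernoff term of order
    w^2, and the Huber scale is a grid point just above tau = t^(1 / al), the natural size of the
    process at time t. *)
Lemma walk_tail_stable (R : realType) (q : nat -> R) (al M t r dl Psi : R)
    (m n : nat) :
  1 <= al < 2 -> 0 < M -> 0 < t -> 0 < dl -> (0 < m)%N -> (0 < n)%N ->
  0 <= r ->
  let eta := m%:R * dl in
  let w := 2 * M * t * eta `^ (- al) / (2 - al) in
  let tau := t `^ (1 / al) in
  let c := M * eta `^ (- (1 + al)) in
  r <= eta -> w < 1 -> tau < eta -> dl <= tau / 16 -> r <= tau / 16 ->
  r * (ln (4 / w) / eta) <= expR (-1) ->
  (forall j, 0 <= q j) ->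
  (forall j, (0 < j < 2 * m)%N -> q j <= M * dl * (j%:R * dl) `^ (- (1 + al))) ->
  (forall k, (0 < k <= m)%N -> tau <= k%:R * dl ->
     \sum_(1 <= j < m.+1)
       dl * (huber (k%:R * dl) (j%:R * dl) * (j%:R * dl) `^ (- (1 + al))) <= Psi) ->
  t * (2 * \sum_(1 <= j < 2 * m) q j) <= n%:R ->
  let p j := t / n%:R * q j in
  let b := 1 - 2 * \sum_(1 <= j < 2 * m) p j in
  iter n (walk p (fun j => j%:R * dl) b (index_iota 1 (2 * m)))
    (fun x => (2 * eta - r <= `|x|)%R%:R) 0 <=
  w ^+ 2 / 8 * expR (2 + expR (-1)) + t * c * (2 * M * t * Psi + tau)
  + 2 * (t * c * eta) ^+ 2.
Proof.
move=> al12 M0 t0 dl0 m0 n0 r0; cbv zeta.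
set eta := m%:R * dl; set w := 2 * M * t * _ / _; set tau := t `^ _.
set c := M * eta `^ (- (1 + al)); set s := ln (4 / w) / eta.
move=> reta w1 taueta dltau rtau rs q0 qM hPsi tn.
have eta0 : 0 < eta by rewrite mulr_gt0// ltr0n.
have w0 : 0 < w.
  apply: divr_gt0; last by lra.
  by apply: mulr_gt0; [apply: mulr_gt0 => //; lra|exact: powR_gt0].
have tau0 : 0 < tau by exact: powR_gt0.
have c0 : 0 < c by rewrite mulr_gt0// powR_gt0.
have w4 : 1 < 4 / w by rewrite ltr_pdivlMr//; lra.
have s0 : 0 < s by rewrite divr_gt0// ln_gt0.
(* k is one more than the integer part of tau / dl; the strict inequality tau < eta keeps it at most
   m. *)
have [k [k0 km tauk ktau]] : exists k, [/\ (0 < k)%N, (k <= m)%N,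
    tau <= k%:R * dl & k%:R * dl <= tau + dl].
  have td0 : 0 <= tau / dl by rewrite divr_ge0// ltW.
  exists (Num.truncn (tau / dl)).+1; split => //.
  - by rewrite truncn_lt_nat// ltr_pdivrMr.
  - by rewrite -ler_pdivrMr// ltW// truncnS_gt.
  - rewrite -natr1 mulrDl mul1r lerD2r -ler_pdivlMr//.
    by rewrite truncn_le.
set a := k%:R * dl in tauk ktau.
have a0 : 0 < a by exact: lt_le_trans tauk.
have qc j : (m <= j < 2 * m)%N -> q j <= c * dl.
  move=> /andP[mj j2m]; have j0 := leq_trans m0 mj.
  apply: le_trans (qM j _) _; first by rewrite j0.
  have -> : c * dl = M * dl * eta `^ (- (1 + al)) by rewrite /c; ring.
  apply: ler_wpM2l; first by rewrite mulr_ge0// ltW.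
  have j0' : 0 < j%:R * dl by rewrite mulr_gt0// ltr0n.
  rewrite !powRN lef_pV2 ?posrE ?powR_gt0//.
  apply: ge0_ler_powR; rewrite ?nnegrE; [lra|exact: ltW|exact: ltW|].
  by rewrite (ler_wpM2r (ltW dl0))// ler_nat.
have := walk_tail _ q dl t c r s a m n q0 (ltW dl0) (ltW t0) (ltW c0) r0 reta
  (ltW s0) a0 m0 n0 qc tn.
cbv zeta; rewrite -/eta => H; apply: le_trans H _.
apply: lerD => //; apply: lerD.
- have := sum_dcosh_grid _ q al M dl s m al12 dl0 m0 s0 (ltW M0) q0.
  rewrite -/eta.
  have qM' j : (0 < j < m)%N -> q j <= M * dl * (j%:R * dl) `^ (- (1 + al)).
    by move=> /andP[j0 jm]; rewrite qM// j0/= (leq_trans jm)// leq_pmull.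
  move=> /(_ qM') /(ler_wpM2l (ltW t0)) H.
  have sE : s * eta = ln (4 / w) by rewrite /s; field; rewrite gt_eqF.
  have w4p : 0 < 4 / w by exact: lt_trans w4.
  have dE : dcosh (s * eta) = 4 / w + w / 4.
    rewrite sE /dcosh expRN lnK ?posrE//; congr (_ + _).
    by field; rewrite gt_eqF.
  rewrite dE in H.
  have e1 : t * \sum_(1 <= j < m) q j * (dcosh (s * (j%:R * dl)) - 2)
      - s * (2 * eta - r) <= 2 + expR (-1) - (ln (4 / w) + ln (4 / w)).
    have -> : s * (2 * eta - r) = ln (4 / w) + ln (4 / w) - r * s.
      by rewrite -sE; ring.
    (* By the choice of [s] the left side is (w / 2) (4 / w + w / 4 - 2) = 2 - w (1 - w / 8). *)
    have : t * (M * eta `^ (- al) / (2 - al) * (4 / w + w / 4 - 2)) <= 2.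
      have wE X : t * (M * eta `^ (- al) / (2 - al) * X) = w / 2 * X.
        by rewrite /w; field; lra.
      rewrite wE.
      have -> : w / 2 * (4 / w + w / 4 - 2) = 2 - w * (1 - w / 8).
        by field; rewrite gt_eqF.
      by rewrite gerBl mulr_ge0//; lra.
    by move=> h; have := le_trans H h; lra.
  rewrite -ler_expR in e1.
  apply: le_trans (ler_wpM2l _ e1) _ => //.
  rewrite expRB expRD lnK ?posrE//.
  by rewrite le_eqVlt; apply/orP; left; apply/eqP; field; rewrite gt_eqF.
- apply: ler_wpM2l; first by rewrite mulr_ge0// ltW.
  have h := hPsi k _ tauk; rewrite k0 km in h; have {h} := h isT.
  rewrite -/a => h.
  have : 2 * (\sum_(1 <= j < m) q j * huber a (j%:R * dl)) <= 2 * (M * Psi).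
    rewrite ler_wpM2l//; apply: le_trans (ler_wpM2l (ltW M0) h).
    rewrite mulr_sumr big_nat_recr//=; apply: ler_wpDr.
      by rewrite !mulr_ge0 ?powR_ge0 ?huber_ge0// ltW.
    apply: ler_sum_nat => j /andP[j1 jm].
    have h2 : q j <= M * dl * (j%:R * dl) `^ (- (1 + al)).
      by rewrite qM// j1 (leq_trans jm)// leq_pmull.
    apply: le_trans (ler_wpM2r (huber_ge0 _ a (j%:R * dl) a0) h2) _.
    by rewrite le_eqVlt; apply/orP; left; apply/eqP; ring.
  (* The other summands fit into [tau]: a / 2 + 2 r + 2 dl <= (tau + tau / 16) / 2 + tau / 4 <=
     tau. *)
  move/(ler_wpM2l (ltW t0)); lra.
Qed.

(** Since t = tau^al, one has t tau^(1 - al) = tau, which turns the one-jump term into the leading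
    term. The two others are multiples of (t M eta^(- al))^2, compared with those of [E1] by 4^al <=
    16 and al^2 <= 4. *)
Lemma tail_constants_gt1 (R : realType) (al M t eps : R) :
  1 < al < 2 -> 0 < M -> 0 < t -> 0 < eps ->
  let eta := eps / 2 in
  let w := 2 * M * t * eta `^ (- al) / (2 - al) in
  let tau := t `^ (1 / al) in
  let c := M * eta `^ (- (1 + al)) in
  let Psi := tau `^ (1 - al) / (al * (2 - al) * (al - 1)) in
  w ^+ 2 / 8 * expR (2 + expR (-1)) + t * c * (2 * M * t * Psi + tau)
  + 2 * (t * c * eta) ^+ 2 <=
  2 `^ (2 + al) * M * t `^ (1 + 1 / al) / eps `^ (1 + al)
    * (1 + M / (al * (2 - al) * (al - 1)))
  + 2 * t ^+ 2 * M ^+ 2 * E1 al * eps `^ (- (2 * al)).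
Proof.
move=> /andP[al1 al2] M0 t0 eps0; cbv zeta.
set eta := eps / 2; set tau := t `^ (1 / al).
have eta0 : 0 < eta by rewrite divr_gt0.
have tau0 : 0 < tau by exact: powR_gt0.
have epsE : eps = 2 * eta by rewrite /eta; field.
have tE : t `^ (1 + 1 / al) = t * tau.
  by rewrite powRD ?(gt_eqF t0) ?implybT// powRr1// ltW.
have tauE : t * tau `^ (1 - al) = tau.
  have {1}-> : t = tau `^ al by rewrite -powRrM mul1r mulVf ?powRr1 ?ltW//; lra.
  rewrite -powRD ?(gt_eqF tau0) ?implybT// (_ : al + (1 - al) = 1); last by ring.
  by rewrite powRr1// ltW.
set X := eta `^ (- al); set D := al * (2 - al) * (al - 1).
have X0 : 0 < X by exact: powR_gt0.
have D0 : 0 < D by rewrite !mulr_gt0//; lra.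
have cE : eta `^ (- (1 + al)) = X / eta.
  rewrite opprD powRD ?(gt_eqF eta0) ?implybT// powR_inv1 ?ltW//.
  by rewrite mulrC.
have e1 : 2 `^ (2 + al) / eps `^ (1 + al) = 2 * (X / eta).
  rewrite epsE (powRM _ _ (ltW eta0))// -cE powRN.
  rewrite (_ : 2 + al = 1 + (1 + al)); last by ring.
  rewrite [2 `^ (1 + (1 + al))]powRD ?pnatr_eq0 ?implybT// powRr1//.
  by field; rewrite !gt_eqF ?powR_gt0.
set Z := 4 `^ al : R.
have Z0 : 0 < Z by exact: powR_gt0.
have e2 : eps `^ (- (2 * al)) = X ^+ 2 / Z.
  rewrite epsE (powRM _ _ (ltW eta0))// mulrC; congr (_ * _).
    by rewrite expr2 -powRD ?(gt_eqF eta0) ?implybT//; congr powR; ring.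
  rewrite powRN; congr (_^-1); rewrite powRrM /Z; congr powR.
  by rewrite (powR_mulrn 2)//; ring.
have Z16 : Z <= 16.
  have -> : 16 = 4 `^ 2 :> R by rewrite (powR_mulrn 2)//; ring.
  by apply: ler_powR; lra.
rewrite cE e2 tE.
have -> : t * (M * (X / eta)) * (2 * M * t * (tau `^ (1 - al) / D) + tau) =
    M * (X / eta) * (t * tau) * (1 + 2 * M / D).
  by rewrite -{2}tauE -[in RHS]tauE; field; rewrite !gt_eqF.
have -> : t * (M * (X / eta)) * eta = t * M * X by field; rewrite gt_eqF.
have -> : 2 `^ (2 + al) * M * (t * tau) / eps `^ (1 + al) * (1 + M / D) =
    2 `^ (2 + al) / eps `^ (1 + al) * (M * (t * tau) * (1 + M / D)) by ring.
rewrite e1.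
rewrite addrAC addrC; apply: lerD.
  have -> : 2 * (X / eta) * (M * (t * tau) * (1 + M / D)) =
    M * (X / eta) * (t * tau) * (2 + 2 * M / D) by ring.
  apply: ler_wpM2l; last by lra.
  by rewrite !mulr_ge0 ?invr_ge0 ?ltW.
rewrite /E1 -expRN; set E := expR _.
have E0 : 0 < E by exact: expR_gt0.
rewrite [4 `^ (1 + al)]powRD ?pnatr_eq0 ?implybT// powRr1// -/Z.
set V := 2 `^ (al + 1) / _.
have V0 : 0 <= V by rewrite divr_ge0 ?powR_ge0// !mulr_ge0//; lra.
have -> : 2 * t ^+ 2 * M ^+ 2 * (4 * E / (2 - al) ^+ 2 + 4 * Z / al ^+ 2 + V)
    * (X ^+ 2 / Z) = (t * M * X) ^+ 2 * (8 * E / (2 - al) ^+ 2 / Z)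
    + (t * M * X) ^+ 2 * (8 / al ^+ 2) + 2 * (t * M * X) ^+ 2 * V / Z.
  by field; rewrite !gt_eqF//; lra.
have K0 : 0 <= (t * M * X) ^+ 2 by exact: sqr_ge0.
have -> : (2 * M * t * X / (2 - al)) ^+ 2 / 8 * E =
  (t * M * X) ^+ 2 * (8 * E / (2 - al) ^+ 2 / 16) by field; lra.
apply: ler_wpDr.
  by apply: divr_ge0; [rewrite mulr_ge0// mulr_ge0|exact: ltW].
apply: lerD.
  apply: ler_wpM2l => //; apply: ler_wpM2l; last by rewrite lef_pV2 ?posrE.
  by rewrite divr_ge0 ?sqr_ge0// mulr_ge0// ltW.
rewrite mulrC; apply: ler_wpM2l => //.
rewrite ler_pdivlMr; last by rewrite exprn_gt0//; lra.
have : al * al <= 2 * 2 by apply: ler_pM; lra.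
by rewrite expr2; lra.
Qed.

Lemma tail_constants_1 (R : realType) (M t eps : R) :
  0 < M -> 0 < t -> t < eps / 2 ->
  let eta := eps / 2 in
  let w := 2 * M * t * eta `^ (- 1) / (2 - 1) in
  let tau := t `^ (1 / 1) in
  let c := M * eta `^ (- (1 + 1)) in
  let Psi := 1 / 2 + ln (eta / tau) in
  w ^+ 2 / 8 * expR (2 + expR (-1)) + t * c * (2 * M * t * Psi + tau)
  + 2 * (t * c * eta) ^+ 2 <=
  4 * t ^+ 2 * M ^+ 2 / eps ^+ 2 * (expR (2 + (expR 1)^-1) + 37 / 9)
  + 4 * M * t ^+ 2 / eps ^+ 2
  + 16 * M ^+ 2 / eps ^+ 2 * t ^+ 2 * ln (eps / (2 * t)).
Proof.
move=> M0 t0 teps; cbv zeta.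
have eps0 : 0 < eps by lra.
have eta0 : 0 <= eps / 2 by lra.
rewrite divr1 (powRr1 (ltW t0)) -expRN (powR_inv1 eta0).
have -> : eps / 2 / t = eps / (2 * t) by field; lra.
rewrite (_ : - (1 + 1) = - 2%:R); last by ring.
rewrite (powR_invn 2 eta0); set E := expR (2 + _); set L := ln _.
have L0 : 0 <= L by apply: ln_ge0; rewrite ler_pdivlMr; lra.
have E0 : 0 < E by exact: expR_gt0.
rewrite -subr_ge0.
(* The terms in M t^2 cancel, and what is left is a square times a nonnegative factor. *)
have -> : 4 * t ^+ 2 * M ^+ 2 / eps ^+ 2 * (E + 37 / 9)
  + 4 * M * t ^+ 2 / eps ^+ 2 + 16 * M ^+ 2 / eps ^+ 2 * t ^+ 2 * L -
  ((2 * M * t / (eps / 2) / (2 - 1)) ^+ 2 / 8 * E +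
  t * (M * (eps / 2) ^- 2) * (2 * M * t * (1 / 2 + L) + t) +
  2 * (t * (M * (eps / 2) ^- 2) * (eps / 2)) ^+ 2) =
  (t * M / eps) ^+ 2 * (2 * E + 40 / 9 + 8 * L) by field; lra.
by rewrite mulr_ge0 ?sqr_ge0//; lra.
Qed.

(** * Elementary trigonometric bounds and the exponential limit *)

Lemma cos_lipschitz (R : realType) (x y : R) : `|cos x - cos y| <= `|x - y|.
Proof.
wlog xy : x y / y <= x => [H|].
  have [|/ltW xy] := leP y x; first exact: H.
  by rewrite distrC (distrC x) H.
have [z _ ->] := MVT_closed _ cos (fun z => - sin z) y x xy
  (fun z _ => is_derive_cos z).
by rewrite normrM normrN ler_piMl// sin_max.
Qed.

Lemma sin_lipschitz0 (R : realType) (x : R) : `|sin x| <= `|x|.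
Proof.
wlog x0 : x / 0 <= x => [H|].
  have [|/ltW x0] := leP 0 x; first exact: H.
  by rewrite -(opprK x) sinN normrN (normrN (- x)) H// oppr_ge0.
have [z _] := MVT_closed _ sin cos 0 x x0 (fun z _ => is_derive_sin z).
by rewrite sin0 !subr0 => ->; rewrite normrM ler_piMl// cos_max.
Qed.

Lemma cosB1_quadratic (R : realType) (x : R) : `|cos x - 1| <= x ^+ 2 / 2.
Proof.
have -> : cos x - 1 = - (2 * sin (x / 2) ^+ 2).
  have {1}-> : x = x / 2 *+ 2 by rewrite -mulr_natr; field.
  by rewrite cos_mulr2n cos2sin2 mulr2n; ring.
rewrite normrN ger0_norm; last by rewrite mulr_ge0// sqr_ge0.
have : `|sin (x / 2)| ^+ 2 <= `|x / 2| ^+ 2.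
  by rewrite lerXn2r ?nnegrE// sin_lipschitz0.
by rewrite !real_normK ?num_real//; lra.
Qed.

Lemma bernoulli_inequality (R : realDomainType) (x : R) n : -1 <= x ->
  1 + n%:R * x <= (1 + x) ^+ n.
Proof.
move=> x1; elim: n => [|n IH]; first by rewrite mul0r addr0 expr0.
rewrite exprS; have x10 : 0 <= 1 + x by lra.
apply: le_trans (ler_wpM2l x10 IH).
have : 0 <= n%:R * x ^+ 2 by rewrite mulr_ge0// sqr_ge0.
by rewrite -natr1; lra.
Qed.

(** Squeezed between exp(x / (1 + x / n)) and exp x. Both bounds come from 1 + z <= exp z: with z =
    y for the upper one, with z = - y / (1 + y), where 1 + z = 1 / (1 + y), for the lower one. *)
Lemma cvg_expR_compound (R : realType) (x : R) :
  (1 + x / n%:R) ^+ n @[n --> \oo] --> expR x.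
Proof.
have inv0 : n%:R^-1 @[n --> \oo] --> (0 : R).
  by apply/gtr0_cvgV0; [near=> n; rewrite ltr0n; near: n; exact: nbhs_infty_gt
    |exact: cvgr_idn].
have x0 : x / n%:R @[n --> \oo] --> (0 : R).
  by rewrite -[X in _ --> X](mulr0 x); apply: cvgM => //; exact: cvg_cst.
have y0 : x / (1 + x / n%:R) @[n --> \oo] --> x.
  rewrite -[X in _ --> X]mulr1; apply: cvgM; first exact: cvg_cst.
  rewrite -[X in _ --> X]invr1; apply: cvgV.
    exact: oner_neq0.
  by rewrite -[X in _ --> X]addr0; apply: cvgD => //; exact: cvg_cst.
have lower := cvg_comp _ _ y0 (@continuous_expR R x).
apply: (@squeeze_cvgr _ _ _ _ (fun n => expR (x / (1 + x / n%:R))) (fun=> expR x)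
  _ _ _ lower); last exact: cvg_cst.
near=> n.
have n0 : 0 < n%:R :> R by rewrite ltr0n; near: n; exact: nbhs_infty_gt.
have y1 : `|x / n%:R| < 1.
  near: n; exact: (@cvgr0_norm_lt _ _ _ _ _ _ x0 1 ltr01).
set y := x / n%:R in y1 *.
have y10 : 0 < 1 + y by move: y1; rewrite ltr_norml => /andP[]; lra.
have xE : x = n%:R * y by rewrite /y; field; rewrite gt_eqF.
apply/andP; split.
  rewrite xE -mulrA expRM_natl lerXn2r ?nnegrE ?expR_ge0 ?(ltW y10)//.
  rewrite -[leRHS]invrK -[leLHS]invrK -expRN lef_pV2 ?posrE ?invr_gt0 ?expR_gt0//.
  apply: le_trans (expR_ge1Dx _).
  by rewrite le_eqVlt; apply/orP; left; apply/eqP; field; rewrite gt_eqF.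
rewrite xE expRM_natl lerXn2r ?nnegrE ?expR_ge0 ?(ltW y10)//.
exact: expR_ge1Dx.
Unshelve. all: by end_near. Qed.

(** * The characteristic function under symmetry *)

Lemma cexp_imaginary (R : realType) (r : R) :
  cexp ('i * r%:C%C) = (cos r +i* sin r)%C.
Proof.
rewrite -complexiE.
rewrite /cexp /= !mul0r mul1r sub0r add0r oppr0 expR0.
by apply/eqP; rewrite eq_complex /= !mul1r !mul0r subr0 addr0 !eqxx.
Qed.

Lemma measurable_ball0 (R : realType) (eps : R) :
  measurable [set x : measurableTypeR R | `|x| <= eps].
Proof.
have -> : [set x : measurableTypeR R | `|x| <= eps] = `[- eps, eps]%classic.
  by apply/seteqP; split => x /=; rewrite in_itv/= ler_norml.
exact: measurable_itv.
Qed.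

Lemma measurable_cosM (R : realType) (u : R) :
  measurable_fun setT (fun x : measurableTypeR R => cos (u * x)).
Proof.
apply: (@continuous_measurable_fun R (fun x => cos (u * x))) => x.
apply: (@continuous_comp _ _ _ ( *%R u) cos).
  exact: mulrl_continuous.
exact: continuous_cos.
Qed.

Lemma measurable_sinM (R : realType) (u : R) :
  measurable_fun setT (fun x : measurableTypeR R => sin (u * x)).
Proof.
apply: (@continuous_measurable_fun R (fun x => sin (u * x))) => x.
apply: (@continuous_comp _ _ _ ( *%R u) sin).
  exact: mulrl_continuous.
exact: continuous_sin.
Qed.

(** Symmetry makes [nu] its own image under x -> - x, which exchanges the positive and the negative
    part of an odd function. *)
Lemma symmetric_Rintegral_odd (R : realType)
    (nu : {measure set (measurableTypeR R) -> \bar R})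
    (D : set (measurableTypeR R)) (g : measurableTypeR R -> R) :
  symmetric_measure nu -> measurable D -> (forall x, D x -> D (- x)) ->
  measurable_fun setT g -> (forall x, g (- x) = - g x) ->
  Rintegral nu D g = 0.
Proof.
move=> sym mD symD mg odd.
rewrite /Rintegral integralE.
have mopp : measurable_fun setT (-%R : measurableTypeR R -> measurableTypeR R).
  exact: (continuous_measurable_fun (@oppr_continuous R R)).
have mgE : measurable_fun D (EFin \o g).
  by apply/measurable_EFinP; exact: measurable_funS mg.
have -> : (\int[nu]_(x in D) ((fun x => (g x)%:E)^\- x) =
    \int[nu]_(x in D) ((fun x => (g x)%:E)^\+ x))%E.
  have preD : (-%R : measurableTypeR R -> measurableTypeR R) @^-1` D = D.
    apply/seteqP; split => x /= Dx; last exact: symD.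
    by rewrite -(opprK x); exact: symD.
  transitivity (\int[pushforward nu
      (-%R : measurableTypeR R -> measurableTypeR R)]_(x in D)
     ((fun x => (g x)%:E)^\+ x))%E; last first.
    apply: eq_measure_integral => A mA _; exact: sym.
  rewrite (ge0_integral_pushforward mopp nu mD (measurable_funepos mgE))//.
  rewrite preD; apply: eq_integral => x _ /=.
  by rewrite funeposE funenegE /= odd.
(* If the common value of the two integrals is infinite, their difference is an infinite value,
   which [fine] sends to 0. *)
case: (\int[nu]_(x in D) _)%E => [r| |]//=.
by rewrite subrr.
Qed.

(** The real part of the characteristic function: the imaginary part of the exponent is the integral
    of the odd function sin(u x) - u x, hence 0. *)
Lemma small_jumps_cos (R : realType) (d : measure_display) (T : measurableType d)
    (P : probability T R) (nu : {measure set (measurableTypeR R) -> \bar R})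
    (eps t u : R) (X : R -> {RV P >-> R}) :
  symmetric_measure nu -> small_jumps_process P nu eps X -> 0 <= t ->
  Rintegral P setT (fun w => cos (u * X t w)) =
  expR (t * Rintegral nu [set x : measurableTypeR R | `|x| <= eps]
              (fun x => cos (u * x) - 1)).
Proof.
move=> sym [_ charX] t0; have := congr1 (@complex.Re R) (charX t u t0).
have -> : complex.Re (charfun P (X t) u) =
    Rintegral P setT (fun w => cos (u * X t w)).
  by apply: eq_Rintegral => w _; rewrite cexp_imaginary.
move=> ->; rewrite /Cintegral.
have -> : (fun x => complex.Re (cexp ('i * (u * x)%:C%C) - 1 - 'i * (u * x)%:C%C)) =
   (fun x : measurableTypeR R => cos (u * x) - 1).
  by apply/funext => x; rewrite cexp_imaginary -complexiE /= mul0r mul1r subrr subr0.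
have -> : (fun x => complex.Im (cexp ('i * (u * x)%:C%C) - 1 - 'i * (u * x)%:C%C)) =
   (fun x : measurableTypeR R => sin (u * x) - u * x).
  by apply/funext => x; rewrite cexp_imaginary -complexiE /= mul0r mul1r add0r subr0.
rewrite (@symmetric_Rintegral_odd _ nu _ (fun x => sin (u * x) - u * x))//.
- by rewrite /cexp /= !mul0r !mulr0 !subr0 addr0 cos0 mulr1.
- exact: measurable_ball0.
- by move=> x /=; rewrite normrN.
- apply: measurable_funB; first exact: measurable_sinM.
  exact: (continuous_measurable_fun (@mulrl_continuous R u)).
- by move=> x; rewrite mulrN sinN; ring.
Qed.

(** * Discretization of the Lévy measure *)

(** The density bound decreases in |x|, so it is taken at the left end of the cell, the very point
    to which the walk moves the mass. *)
Lemma class_L_itv (R : realType)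
    (nu : {measure set (measurableTypeR R) -> \bar R}) (f : R -> R)
    (M al a b : R) :
  has_lebesgue_density nu f -> class_L M al f -> 0 <= M -> -1 <= al ->
  0 < a -> a <= b -> b <= 2 ->
  (nu `]a, b]%classic <= (M * (b - a) * a `^ (- (1 + al)))%:E)%E.
Proof.
move=> [mf f0 ->//] fL M0 al1 a0 ab b2.
have mi : measurable (`]a, b]%classic : set (measurableTypeR R)).
  exact: measurable_itv.
have C0 : 0 <= M * a `^ (- (1 + al)) by rewrite mulr_ge0// powR_ge0.
apply: (@le_trans _ _ (\int[lebesgue_measure]_(x in
    (`]a, b]%classic : set (measurableTypeR R)))
    (cst (M * a `^ (- (1 + al)))%:E x))%E).
  apply: ge0_le_integral => //.
  - by move=> x _; rewrite lee_fin.
  - by apply/measurable_EFinP; exact: measurable_funTS.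
  - move=> x /=; rewrite in_itv/= lee_fin => /andP[ax xb].
    have x0 : 0 < x by exact: lt_trans ax.
    have x2 : `|x| <= 2 by rewrite gtr0_norm// (le_trans xb).
    have xn : 0 < `|x| by rewrite gtr0_norm.
    apply: le_trans (fL x xn x2) _; apply: ler_wpM2l => //.
    rewrite gtr0_norm// !powRN lef_pV2 ?posrE ?powR_gt0//.
    by apply: ge0_ler_powR; rewrite ?nnegrE; lra.
have mu_ab : lebesgue_measure (`]a, b]%classic : set R) = (b - a)%:E.
  rewrite lebesgue_measure_itv/= lte_fin; case: ifPn => [_|]; first by rewrite EFinB.
  by rewrite -leNgt => ba; have -> : b = a; [lra|rewrite subrr].
rewrite integral_cst//.
rewrite [X in (_ * X <= _)%E]mu_ab.
by rewrite -EFinM lee_fin le_eqVlt; apply/orP; left; apply/eqP; ring.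
Qed.

Definition annulus {R : realType} (a b : R) : set (measurableTypeR R) :=
  [set x : measurableTypeR R | a < `|x| <= b].

Lemma annulusE (R : realType) (a b : R) : 0 <= a ->
  annulus a b = `]a, b]%classic `|` [set x | `]a, b]%classic (- x)].
Proof.
move=> a0; apply/seteqP; split => x; rewrite /annulus /= !in_itv/=.
  have [x0|x0] := leP 0 x; first by rewrite ger0_norm//; left.
  by rewrite ltr0_norm//; right.
move=> [] /andP[ax xb].
  by rewrite ger0_norm ?ax// (le_trans a0)// ltW.
by rewrite ler0_norm ?ax//; have := le_lt_trans a0 ax; lra.
Qed.

Lemma measurable_opp_itv (R : realType) (a b : R) :
  measurable [set x : measurableTypeR R | `]a, b]%classic (- x)].
Proof.
have mopp := continuous_measurable_fun (@oppr_continuous R R).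
by rewrite -[X in measurable X]setTI; apply: mopp => //; exact: measurable_itv.
Qed.

Lemma measurable_annulus (R : realType) (a b : R) : 0 <= a ->
  measurable (annulus a b).
Proof.
move=> a0; rewrite annulusE//; apply: measurableU; first exact: measurable_itv.
exact: measurable_opp_itv.
Qed.

Lemma symmetric_annulus (R : realType)
    (nu : {measure set (measurableTypeR R) -> \bar R}) (a b : R) :
  symmetric_measure nu -> 0 <= a ->
  nu (annulus a b) = (nu `]a, b]%classic + nu `]a, b]%classic)%E.
Proof.
move=> sym a0; have mi : measurable (`]a, b]%classic : set (measurableTypeR R)).
  exact: measurable_itv.
rewrite annulusE// measureU//; [|exact: measurable_opp_itv|].
  by congr (_ + _)%E; exact: sym.
apply/seteqP; split => x //=; rewrite !in_itv/= => -[/andP[ax _] /andP[xa _]].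
by have := lt_trans xa (_ : - x < a); lra.
Qed.

(* On the j-th annulus of the grid the summand is 1 - cos (th y) for the left end
   y = j dl of the cell containing |x|. *)
Lemma grid_cos_sum (R : realType) (th dl x : R) N : 0 <= dl ->
  `|x| <= N.+1%:R * dl ->
  exists y, [/\ \sum_(1 <= j < N.+1) (1 - cos (th * (j%:R * dl))) *
      \1_(annulus (j%:R * dl) (j.+1%:R * dl)) x = 1 - cos (th * y),
    0 <= y, y <= `|x| & `|x| <= y + dl].
Proof.
move=> d0; elim: N => [|N IH] xN.
  (* No jump represents the cell next to 0, whose mass may be infinite: there the sum is empty and y
     = 0. *)
  exists 0; rewrite big_geq// mulr0 cos0 subrr; split => //.
  by rewrite add0r -[dl]mul1r.
have [xN'|xN'] := leP `|x| (N.+1%:R * dl).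
  have [y [yE y0 yx xy]] := IH xN'; exists y; split => //.
  rewrite big_nat_recr//= yE indicE memNset ?mulr0 ?addr0// => -[].
  by rewrite /annulus/= ltNge xN'.
exists (N.+1%:R * dl); split; [|exact: mulr_ge0|exact: ltW|]; last first.
  by rewrite -[dl in X in _ <= _ + X]mul1r -mulrDl natr1.
rewrite big_nat_recr//= indicE mem_set ?mulr1; last by rewrite /annulus/= xN' xN.
rewrite big_nat big1 ?add0r// => j /andP[_ jN].
rewrite indicE memNset ?mulr0// /annulus/= => /andP[_].
rewrite leNgt => /negP; apply; apply: le_lt_trans xN'.
by rewrite ler_wpM2r// ler_nat.
Qed.

Lemma integrable_levy_sqr (R : realType)
    (nu : {measure set (measurableTypeR R) -> \bar R}) (eps c : R) :
  levy_measure nu -> eps <= 1 -> 0 <= c ->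
  nu.-integrable [set x : measurableTypeR R | `|x| <= eps]
    (fun x => (c * x ^+ 2)%:E).
Proof.
move=> [_ fin] e1 c0; set D := [set x | _].
have mD : measurable D by exact: measurable_ball0.
have mx2 : measurable_fun setT (fun x : measurableTypeR R => x ^+ 2).
  exact: (continuous_measurable_fun (@exprn_continuous R 2)).
have mm : measurable_fun setT (fun x : measurableTypeR R => (Num.min (x ^+ 2) 1)%:E).
  by apply/measurable_EFinP; apply: measurable_minr.
have i1 : nu.-integrable D (fun x => (x ^+ 2)%:E).
  apply/integrableP; split; first by apply/measurable_EFinP; exact: measurable_funTS.
  apply: le_lt_trans fin.
  have -> : (\int[nu]_(x in D) `|(x ^+ 2)%:E| =
      \int[nu]_(x in D) (Num.min (x ^+ 2) 1)%:E)%E.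
    apply: eq_integral => x; rewrite inE /D/= => xe.
    rewrite ger0_norm ?sqr_ge0// min_l//.
    rewrite -(real_normK (num_real x)) expr_le1//; exact: le_trans e1.
  apply: ge0_subset_integral => // x _; rewrite lee_fin le_min sqr_ge0.
  exact: ler01.
have := integrableZl mD c i1.
by apply: eq_integrable => // x _; rewrite EFinM.
Qed.

Lemma integrable_cos_levy (R : realType)
    (nu : {measure set (measurableTypeR R) -> \bar R}) (eps th : R) :
  levy_measure nu -> eps <= 1 ->
  nu.-integrable [set x : measurableTypeR R | `|x| <= eps]
    (EFin \o (fun x => 1 - cos (th * x))).
Proof.
move=> lev eps1; have c0 : 0 <= th ^+ 2 / 2 by rewrite divr_ge0// sqr_ge0.
apply: le_integrable (integrable_levy_sqr _ nu eps _ lev eps1 c0).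
- exact: measurable_ball0.
- apply/measurable_EFinP; apply: measurable_funTS.
  by apply: measurable_funB => //; exact: measurable_cosM.
- move=> x _; rewrite /= lee_fin distrC.
  apply: le_trans (cosB1_quadratic _ _) _.
  have h2 : 0 <= th ^+ 2 / 2 * x ^+ 2 by rewrite mulr_ge0// sqr_ge0.
  by rewrite exprMn ger0_norm//; lra.
Qed.

(** Dominated convergence. The sum is the integral of 1 - cos(th y), where y is the end nearest to 0
    of the cell of |x|; as y <= |x|, the integrand is at most th^2 x^2 / 2, which is integrable. *)
Lemma cvg_grid_exponent (R : realType)
    (nu : {measure set (measurableTypeR R) -> \bar R}) (f : R -> R)
    (M al eps th : R) :
  levy_measure nu -> symmetric_measure nu -> has_lebesgue_density nu f ->
  class_L M al f -> 0 <= M -> -1 <= al -> 0 < eps -> eps <= 1 ->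
  let dl m : R := eps / 2 / m%:R in
  \sum_(1 <= j < 2 * m) (1 - cos (th * (j%:R * dl m))) *
    (2 * fine (nu `](j%:R * dl m), (j.+1%:R * dl m)]%classic))
    @[m --> \oo] -->
  Rintegral nu [set x : measurableTypeR R | `|x| <= eps]
    (fun x => 1 - cos (th * x)).
Proof.
move=> lev sym den fL M0 al1 eps0 eps1; cbv zeta.
set D := [set x | _].
have mD : measurable D by exact: measurable_ball0.
set u := (X in X @ \oo --> _); rewrite -[X in X @ \oo --> _]/u.
(* Passing to m + 1 makes the mesh positive for every index. *)
rewrite -(cvg_shiftS u) {}/u.
pose dl m : R := eps / 2 / m.+1%:R.
have dl0 m : 0 < dl m by rewrite !divr_gt0// ltr0n.
have mdl m : (2 * m.+1)%:R * dl m = eps.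
  by rewrite /dl natrM; field; rewrite gt_eqF// ltr0n.
have c0 y : 0 <= 1 - cos y :> R by rewrite subr_ge0 cos_le1.
pose h m j (x : measurableTypeR R) : \bar R := ((1 - cos (th * (j%:R * dl m)))%:E *
  (\1_(annulus (j%:R * dl m) (j.+1%:R * dl m)) x)%:E)%E.
pose G m (x : measurableTypeR R) : \bar R := (\sum_(1 <= j < 2 * m.+1) h m j x)%E.
have ann m j : measurable (annulus (j%:R * dl m) (j.+1%:R * dl m)).
  by apply: measurable_annulus; rewrite mulr_ge0// ltW.
have mh m j E : measurable_fun E (h m j).
  apply: measurable_funTS; apply: emeasurable_funM; first exact: measurable_cst.
  by apply/measurable_EFinP; exact: measurable_indic.
have h0 m j x : (0 <= h m j x)%E.
  by apply: mule_ge0; rewrite lee_fin// indicE ler0n.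
have GE m x : D x -> exists y, [/\ G m x = (1 - cos (th * y))%:E,
    0 <= y, y <= `|x| & `|x| <= y + dl m].
  move=> Dx; have := grid_cos_sum R th (dl m) x (2 * m.+1).-1 (ltW (dl0 m)).
  rewrite prednK ?muln_gt0// mdl => /(_ Dx)[y [yE y0 yx xy]].
  exists y; split => //; rewrite -yE /G /h sumEFin//.
have key : (\int[nu]_(x in D) G m x)%E @[m --> \oo] -->
    (\int[nu]_(x in D) (1 - cos (th * x))%:E)%E.
  apply: (@dominated_cvg _ _ _ nu D mD G _ (fun x => (th ^+ 2 / 2 * x ^+ 2)%:E)).
  - by move=> m; exact: emeasurable_sum.
  - move=> x Dx; apply/fine_cvgP; split.
      by near=> m; have [y [-> _ _ _]] := GE m x Dx.
    apply/cvgrPdist_le => e e0; near=> m => /=.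
    have [y [-> y0 yx xy]] := GE m x Dx; rewrite /=.
    have -> : 1 - cos (th * x) - (1 - cos (th * y)) = cos (th * y) - cos (th * `|x|).
      have -> : cos (th * `|x|) = cos (th * x).
        have [x0|x0] := leP 0 x; first by rewrite ger0_norm.
        by rewrite ltr0_norm// mulrN cosN.
      by ring.
    apply: le_trans (cos_lipschitz _ _ _) _.
    rewrite -mulrBr normrM (distrC y).
    rewrite (@ger0_norm _ (`|x| - y)) ?subr_ge0//.
    apply: (@le_trans _ _ (`|th| * dl m)); first by rewrite ler_wpM2l// lerBlDl.
    rewrite /dl mulrA ler_pdivrMr ?ltr0n// [leRHS]mulrC -ler_pdivrMr//.
    apply: (@le_trans _ _ m%:R); last by rewrite ler_nat.
    by near: m; exact: nbhs_infty_ger.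
  - by [].
  - by apply: integrable_levy_sqr => //; rewrite divr_ge0// sqr_ge0.
  - move=> m x Dx; have [y [-> y0 yx xy]] := GE m x Dx.
    rewrite /= lee_fin distrC.
    apply: le_trans (cosB1_quadratic _ _) _.
    rewrite exprMn.
    have : y ^+ 2 <= `|x| ^+ 2 by rewrite lerXn2r ?nnegrE.
    rewrite real_normK ?num_real// => /(ler_wpM2l (sqr_ge0 th)); lra.
have intG m : (\int[nu]_(x in D) G m x)%E =
  (\sum_(1 <= j < 2 * m.+1) (1 - cos (th * (j%:R * dl m))) *
    (2 * fine (nu `](j%:R * dl m), (j.+1%:R * dl m)]%classic)))%:E.
  rewrite /G ge0_integral_sum//.
  rewrite -sumEFin big_nat [in RHS]big_nat; apply: eq_bigr => j /andP[j1 jm].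
  have jd0 : 0 < j%:R * dl m by rewrite mulr_gt0// ltr0n.
  have jj : j%:R * dl m <= j.+1%:R * dl m by rewrite ler_wpM2r ?ler_nat ?(ltW (dl0 m)).
  have je : j.+1%:R * dl m <= eps.
    by rewrite -(mdl m) ler_wpM2r ?ler_nat ?(ltW (dl0 m)).
  rewrite /h ge0_integralZl_EFin//; last first.
    by apply/measurable_EFinP; apply: measurable_funTS; exact: measurable_indic.
  rewrite integral_indic// (_ : _ `&` D = annulus (j%:R * dl m) (j.+1%:R * dl m)).
    (* The factor 2 accounts for the mirror cell; the mass is finite by the density bound, since the
       cell stays away from 0. *)
    rewrite symmetric_annulus ?(ltW jd0)// EFinM EFinM fineK.
      by rewrite -mule2n mule_natl.
    rewrite ge0_fin_numE//; apply: le_lt_trans (ltry _).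
    by apply: (class_L_itv _ nu f M al) => //; lra.
  apply/seteqP; split => [x []//|x /=]; rewrite /annulus /D/= => /andP[h1 h2].
  by rewrite h1 h2; split => //; exact: le_trans je.
have fin := integrable_fin_num mD (integrable_cos_levy _ nu eps th lev eps1).
rewrite -(fineK fin) in key.
have fkey := fine_cvg key; move: fkey.
rewrite (_ : fine \o _ = fun m => \sum_(1 <= j < 2 * m.+1)
   (1 - cos (th * (j%:R * dl m))) *
    (2 * fine (nu `](j%:R * dl m), (j.+1%:R * dl m)]%classic))); first exact.
by apply/funext => m; rewrite /= intG.
Unshelve. all: by end_near. Qed.

(** * Convergence of the grid walk to the law of the process *)

(** For j >= 1 the cell stays away from 0, where a Lévy measure is finite, so [fine] keeps the
    mass. *)
Definition grid_rate {R : realType}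
    (nu : {measure set (measurableTypeR R) -> \bar R}) (dl : R) (j : nat) : R :=
  fine (nu `](j%:R * dl), (j.+1%:R * dl)]%classic).

(* Expectation of [F] at the n-th step of the walk on the grid of mesh
   eps / (2 m). *)
Definition grid_law {R : realType}
    (nu : {measure set (measurableTypeR R) -> \bar R}) (eps t : R) (m n : nat)
    (F : R -> R) : R :=
  let dl := eps / 2 / m%:R in
  let p j := t / n%:R * grid_rate nu dl j in
  iter n (walk p (fun j => j%:R * dl) (1 - 2 * \sum_(1 <= j < 2 * m) p j)
    (index_iota 1 (2 * m))) F 0.

(** The order of the limits matters: n goes to infinity at a fixed mesh, which gives a compound
    Poisson law, and then the mesh is refined. Measurability and boundedness make expectations
    linear on such functions. *)
Definition grid_approx {R : realType} {d : measure_display} {T : measurableType d}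
    (P : probability T R) (X : T -> R)
    (nu : {measure set (measurableTypeR R) -> \bar R}) (eps t : R)
    (F : R -> R) : Prop :=
  [/\ measurable_fun setT F, (exists C : R, forall x, `|F x| <= C) &
    forall e : R, 0 < e -> \forall m \near \oo, \forall n \near \oo,
      `|grid_law nu eps t m n F - Rintegral P setT (F \o X)| <= e].

Lemma bounded_comp_integrable (R : realType) (d : measure_display)
    (T : measurableType d) (P : probability T R) (X : T -> R) (F : R -> R) :
  measurable_fun setT X -> measurable_fun setT F ->
  (exists C : R, forall x, `|F x| <= C) ->
  P.-integrable setT (EFin \o (F \o X)).
Proof.
move=> mX mF [C FC]; apply: measurable_bounded_integrable => //.
- exact: le_lt_trans (probability_le1 P measurableT) (ltry 1).
- exact: measurableT_comp.
- exists C; split; first exact: num_real.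
  by move=> y Cy w _ /=; apply: le_trans (FC _) (ltW Cy).
Qed.

Lemma grid_approx_lin (R : realType) (d : measure_display) (T : measurableType d)
    (P : probability T R) (X : T -> R)
    (nu : {measure set (measurableTypeR R) -> \bar R}) (eps t a b : R)
    (F G : R -> R) :
  measurable_fun setT X ->
  grid_approx P X nu eps t F -> grid_approx P X nu eps t G ->
  grid_approx P X nu eps t (fun x => a * F x + b * G x).
Proof.
move=> mX [mF FC cF] [mG GC cG].
have iF := bounded_comp_integrable _ _ _ P X F mX mF FC.
have iG := bounded_comp_integrable _ _ _ P X G mX mG GC.
split.
- by apply: measurable_funD; apply: measurable_funM.
- move: FC GC => [C FC] [C' GC]; exists (`|a| * C + `|b| * C') => x.
  apply: le_trans (ler_normD _ _) _; rewrite !normrM.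
  by apply: lerD; exact: ler_wpM2l.
(* The summand 1 keeps [k] positive when a = b = 0. *)
- move=> e e0; set k := `|a| + `|b| + 1.
  have k0 : 0 < k by rewrite ltr_wpDl// addr_ge0.
  have ek0 : 0 < e / k by rewrite divr_gt0.
  have := cG _ ek0; have := cF _ ek0; apply: filterS2 => m.
  apply: filterS2 => n hF hG.
  have -> : grid_law nu eps t m n (fun x => a * F x + b * G x) =
      a * grid_law nu eps t m n F + b * grid_law nu eps t m n G.
    exact: iter_walk_lin.
  have -> : Rintegral P setT ((fun x => a * F x + b * G x) \o X) =
      a * Rintegral P setT (F \o X) + b * Rintegral P setT (G \o X).
    have iZ (c : R) (H : R -> R) : measurable_fun setT H ->
        (exists C : R, forall x, `|H x| <= C) ->
        P.-integrable setT (EFin \o (fun w => c * H (X w))).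
      move=> mH [C HC].
      apply: (bounded_comp_integrable _ _ _ P X (fun x => c * H x)) => //.
        exact: measurable_funM.
      by exists (`|c| * C) => x; rewrite normrM ler_wpM2l.
    rewrite -!RintegralZl// -RintegralD//; exact: iZ.
  set F1 := grid_law _ _ _ _ _ _ in hF *; set G1 := grid_law _ _ _ _ _ G in hG *.
  set F2 := Rintegral _ _ _ in hF *; set G2 := Rintegral _ _ _ in hG *.
  have -> : a * F1 + b * G1 - (a * F2 + b * G2) = a * (F1 - F2) + b * (G1 - G2).
    by ring.
  apply: le_trans (ler_normD _ _) _; rewrite !normrM.
  have -> : e = (`|a| + `|b| + 1) * (e / k) by rewrite /k; field; exact: lt0r_neq0.
  have := ler_wpM2l (normr_ge0 a) hF; have := ler_wpM2l (normr_ge0 b) hG; lra.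
Qed.

Lemma iter_walk_cos (R : realType) (p v : nat -> R) (b : R) r (s x : R) n :
  iter n (walk p v b r) (fun y => cos (s * y)) x =
  (b + 2 * \sum_(j <- r) p j * cos (s * v j)) ^+ n * cos (s * x).
Proof.
set c := b + _.
have W y : walk p v b r (fun y => cos (s * y)) y = c * cos (s * y).
  rewrite /walk /jumps /c mulrDl mulr_sumr mulr_suml; congr (_ + _).
  by apply: eq_bigr => j _; rewrite (mulrDr s) (mulrBr s) cosD cosB; ring.
elim: n x => [|n IH] x /=; first by rewrite expr0 mul1r.
have -> : iter n (walk p v b r) (fun y => cos (s * y)) =
    fun y => c ^+ n * cos (s * y) + 0 * 0.
  by apply/funext => y; rewrite mulr0 addr0.
by rewrite (walk_lin _ _ _ _ _ _ (fun=> 0)) W exprS; ring.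
Qed.

(** One step multiplies the cosine by 1 - (t / n) u_m, with u_m the sum of [cvg_grid_exponent]; the
    n-th power tends to exp(- t u_m), and this to the characteristic function. *)
Lemma grid_approx_cos (R : realType) (d : measure_display) (T : measurableType d)
    (P : probability T R)
    (nu : {measure set (measurableTypeR R) -> \bar R}) (f : R -> R)
    (M al eps t th : R) (X : R -> {RV P >-> R}) :
  levy_measure nu -> symmetric_measure nu -> has_lebesgue_density nu f ->
  class_L M al f -> 0 <= M -> -1 <= al -> 0 < eps -> eps <= 1 -> 0 <= t ->
  small_jumps_process P nu eps X ->
  grid_approx P (X t) nu eps t (fun x => cos (th * x)).
Proof.
move=> lev sym den fL M0 al1 eps0 eps1 t0 sj; split.
- exact: measurable_cosM.
- by exists 1 => x; exact: cos_max.
move=> e e0.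
rewrite (_ : Rintegral _ _ _ = Rintegral P setT (fun w => cos (th * X t w)))//.
rewrite (small_jumps_cos _ _ _ _ _ _ _ _ _ sym sj t0).
set D := [set x | _].
have -> : Rintegral nu D (fun x => cos (th * x) - 1) =
    - Rintegral nu D (fun x => 1 - cos (th * x)).
  rewrite -[RHS]mulN1r -RintegralZl//; last exact: integrable_cos_levy.
    by apply: eq_Rintegral => x _; ring.
  exact: measurable_ball0.
have cpsi := cvg_grid_exponent R nu f M al eps th lev sym den fL M0 al1 eps0 eps1.
cbv zeta in cpsi; rewrite -/D in cpsi.
set psi := Rintegral _ _ _ in cpsi *.
set u := (u in u x @[x --> \oo] --> _) in cpsi.
have cexpu : expR (t * - u m) @[m --> \oo] --> expR (t * - psi).
  have ctu : t * - u m @[m --> \oo] --> t * - psi.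
    by apply: cvgM; [exact: cvg_cst|exact: cvgN].
  exact: (cvg_comp _ _ ctu (@continuous_expR R (t * - psi))).
have e2 : 0 < e / 2 by rewrite divr_gt0.
have /cvgrPdist_le/(_ _ e2) := cexpu; apply: filterS => m hm.
have /cvgrPdist_le/(_ _ e2) := cvg_expR_compound R (t * - u m).
apply: filterS => n hn.
have -> : grid_law nu eps t m n (fun x => cos (th * x)) =
    (1 + t * - u m / n%:R) ^+ n.
  rewrite /grid_law iter_walk_cos mulr0 cos0 mulr1; congr (_ ^+ _).
  have -> : t * - u m / n%:R = - (t / n%:R * u m) by ring.
  rewrite -addrA; congr (_ + _); rewrite /u !mulr_sumr -!sumrN -big_split/=.
  apply: eq_bigr => j _.
  by rewrite /grid_rate; ring.
set A := expR _ in hm *; set B := expR _ in hm hn; set C := _ ^+ n in hn *.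
have -> : C - A = - ((B - C) + (A - B)) by ring.
rewrite normrN; apply: le_trans (ler_normD _ _) _; lra.
Qed.

(** The induction carries an extra factor cos(th x), so that multiplying by cos(ka x) only shifts
    the frequency to th + ka and th - ka. *)
Lemma grid_approx_poly (R : realType) (d : measure_display) (T : measurableType d)
    (P : probability T R)
    (nu : {measure set (measurableTypeR R) -> \bar R}) (eps t ka : R)
    (X : T -> R) (p : {poly R}) :
  measurable_fun setT X ->
  (forall th, grid_approx P X nu eps t (fun x => cos (th * x))) ->
  grid_approx P X nu eps t (fun x => p.[cos (ka * x)]).
Proof.
move=> mX ccos.
have H th : grid_approx P X nu eps t (fun x => p.[cos (ka * x)] * cos (th * x)).
  elim/poly_ind: p th => [|p c IH] th.
    have := grid_approx_lin _ _ _ _ _ _ _ _ 0 0 _ _ mX (ccos 0) (ccos 0).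
    by congr (grid_approx _ _ _ _ _ _); apply/funext => x; rewrite horner0; ring.
  have h1 := grid_approx_lin _ _ _ _ _ _ _ _ (1 / 2) (1 / 2) _ _ mX
    (IH (th + ka)) (IH (th - ka)).
  have := grid_approx_lin _ _ _ _ _ _ _ _ 1 c _ _ mX h1 (ccos th).
  congr (grid_approx _ _ _ _ _ _); apply/funext => x.
  by rewrite hornerMXaddC mulrDl mulrBl cosD cosB; field.
have := H 0; congr (grid_approx _ _ _ _ _ _); apply/funext => x.
by rewrite mul0r cos0 mulr1.
Qed.

(* With u = (1 + y) / 2 the polynomial is (1 - u^n)^k: by Bernoulli's inequality
   it is at least 1 - k u^n and at most 1 / (1 + k u^n). *)
Lemma bump_poly (R : realType) (y1 y0 e : R) :
  -1 < y1 -> y1 < y0 -> y0 <= 1 -> 0 < e ->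
  exists p : {poly R}, [/\ forall y, -1 <= y <= 1 -> 0 <= p.[y] <= 1,
    forall y, -1 <= y <= y1 -> 1 - e <= p.[y] &
    forall y, y0 <= y <= 1 -> p.[y] <= e].
Proof.
move=> y1N y10 y01 e0.
set u1 := (1 + y1) / 2; set u0 := (1 + y0) / 2.
have u1p : 0 < u1 by rewrite /u1; lra.
have u0p : 0 < u0 by rewrite /u0; lra.
have u10 : u1 < u0 by rewrite /u1 /u0; lra.
have u0l : u0 <= 1 by rewrite /u0; lra.
set rho := u0 / u1 - 1.
have rho0 : 0 < rho by rewrite subr_gt0 ltr_pdivlMr// mul1r.
(* [C] is such that (u0 / u1)^n >= C leaves room for an integer k between e^-1 / u0^n and e / u1^n,
   as both estimates on k require. *)
set C := (e^-1 + 1) / e.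
have C0 : 0 < C by rewrite divr_gt0// addr_gt0// invr_gt0.
pose n := (Num.truncn (C / rho)).+1.
have nC : C <= (u0 / u1) ^+ n.
  have := bernoulli_inequality _ rho n _.
  rewrite /rho subrKC => h; apply: le_trans (h _); last by rewrite -/rho; lra.
  rewrite -/rho; apply: ler_wpDl => //.
  by rewrite -ler_pdivrMr// ltW// truncnS_gt.
set z := e^-1 / u0 ^+ n.
have u0n : 0 < u0 ^+ n by exact: exprn_gt0.
have u1n : 0 < u1 ^+ n by exact: exprn_gt0.
have ei0 : 0 < e^-1 by rewrite invr_gt0.
have z0 : 0 <= z by rewrite divr_ge0// ltW.
pose k := (Num.truncn z).+1.
have kz : z <= k%:R by rewrite ltW// truncnS_gt.
have kz1 : k%:R <= z + 1 by rewrite /k -natr1 lerD2r truncn_le.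
have k1 : k%:R * u1 ^+ n <= e.
  have : z + 1 <= (e^-1 + 1) / u0 ^+ n.
    rewrite mulrDl lerD2l mul1r invf_ge1//; apply: exprn_ile1 => //; exact: ltW.
  move=> h; apply: le_trans (ler_wpM2r (ltW u1n) (le_trans kz1 h)) _.
  have -> : (e^-1 + 1) / u0 ^+ n * u1 ^+ n = C * e / (u0 / u1) ^+ n.
    rewrite (expr_div_n u0 u1) /C; move: (u0 ^+ n) (u1 ^+ n) u0n u1n => U0 U1 h0 h1.
    by field; rewrite !gt_eqF.
  have un : 0 < (u0 / u1) ^+ n by rewrite exprn_gt0// divr_gt0.
  by rewrite ler_pdivrMr// mulrC ler_wpM2l// ltW.
have k0 : e^-1 <= k%:R * u0 ^+ n by rewrite -ler_pdivrMr.
pose p : {poly R} := (1 - ((2^-1)%:P * ('X + 1)) ^+ n) ^+ k.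
have pE y : p.[y] = (1 - ((1 + y) / 2) ^+ n) ^+ k.
  rewrite /p !(hornerE, horner_exp) /=.
  by congr (_ ^+ _); congr (_ - _); congr (_ ^+ _); field.
have un01 (y : R) : -1 <= y <= 1 -> 0 <= ((1 + y) / 2) ^+ n <= 1.
  by move=> y1'; rewrite exprn_ge0/= ?exprn_ile1//; lra.
exists p; split => y yb; rewrite pE.
- have := un01 y yb; move: (_ ^+ n) => U U01.
  by rewrite exprn_ge0/= ?exprn_ile1//; lra.
- have U01 : 0 <= ((1 + y) / 2) ^+ n <= 1 by apply: un01; lra.
  have Uu : ((1 + y) / 2) ^+ n <= u1 ^+ n.
    by apply: lerXn2r; rewrite ?nnegrE /u1; lra.
  move: (((1 + y) / 2) ^+ n) U01 Uu => U U01 Uu.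
  have := bernoulli_inequality _ (- U) k; rewrite mulrN => h.
  apply: le_trans (h _); last by lra.
  by have := ler_wpM2l (ler0n R k) Uu; lra.
- have U01 : 0 <= ((1 + y) / 2) ^+ n <= 1 by apply: un01; lra.
  have Uu : u0 ^+ n <= ((1 + y) / 2) ^+ n.
    by apply: lerXn2r; rewrite ?nnegrE /u0; lra.
  move: (((1 + y) / 2) ^+ n) U01 Uu => U U01 Uu.
  have h1 : e^-1 <= (1 + U) ^+ k.
    have := bernoulli_inequality _ U k; move=> h.
    apply: le_trans (h _); last by lra.
    by have := ler_wpM2l (ler0n R k) Uu; lra.
  have h2 : (1 - U) ^+ k * (1 + U) ^+ k <= 1.
    rewrite -exprMn exprn_ile1//.
      by rewrite mulr_ge0//; lra.
    by have := sqr_ge0 U; lra.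
  have h3 : 0 <= (1 - U) ^+ k by rewrite exprn_ge0//; lra.
  have h4 := le_trans (ler_wpM2l h3 h1) h2.
  by rewrite ler_pdivrMr// mul1r in h4.
Qed.

(** * Transfer of the tail bound from the walk to the process *)

Lemma ler_cos_pi (R : realType) (x y : R) : 0 <= x -> x <= y -> y <= pi ->
  cos y <= cos x.
Proof.
move=> x0 xy ypi; rewrite leNgt ltr_cos ?in_itv/= -?leNgt//.
- by rewrite ?x0 ?ypi ?(le_trans x0 xy) ?(le_trans xy ypi).
- by rewrite ?x0 ?ypi ?(le_trans x0 xy) ?(le_trans xy ypi).
Qed.

(** A polynomial in cos(ka x) is periodic, hence the cutoff [b]. It is chosen near 1 on eps <= |x|
    <= b and near 0 on |x| <= eps - r; the gap [r] gives it room to pass from one level to the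
    other. *)
Lemma law_annulus_le (R : realType) (d : measure_display) (T : measurableType d)
    (P : probability T R) (nu : {measure set (measurableTypeR R) -> \bar R})
    (eps t r b B : R) (X : T -> R) :
  measurable_fun setT X ->
  (forall th, grid_approx P X nu eps t (fun x => cos (th * x))) ->
  0 < r < eps -> eps <= b -> 0 <= t ->
  (\forall m \near \oo, \forall n \near \oo,
    t * (2 * \sum_(1 <= j < 2 * m) grid_rate nu (eps / 2 / m%:R) j) <= n%:R /\
    grid_law nu eps t m n (fun x => (eps - r <= `|x|)%R%:R) <= B) ->
  (P [set w | (eps <= `|X w| <= b)%R] <= B%:E)%E.
Proof.
move=> mX ccos /andP[r0 re] eb t0 hB.
have eps0 : 0 < eps by lra.
set A := [set w | _].
have mA : measurable A.
  have -> : A = (fun w => `|X w|) @^-1` `[eps, b]%classic.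
    by apply/seteqP; split => w /=; rewrite in_itv.
  rewrite -[X in measurable X]setTI.
  by apply: measurableT_comp => //; exact: measurable_itv.
have Pfin : (P A = (fine (P A))%:E)%E by rewrite fineK// fin_num_measure.
have P1 : fine (P A) <= 1 by rewrite -lee_fin -Pfin probability_le1.
have P0 : 0 <= fine (P A) by rewrite fine_ge0.
rewrite Pfin lee_fin; apply/ler_addgt0Pr => e' e'0.
(* Three errors: the polynomial on the annulus, the polynomial near 0, and the approximation by the
   walk. *)
set e := e' / 3; have e0 : 0 < e by rewrite divr_gt0.
have pi0 := @pi_gt0 R.
(* With b + 1 instead of b, ka |x| stays below pi on the annulus, and cos(ka eps) > -1 as
   [bump_poly] requires. *)
pose ka := pi / (b + 1) : R.
have b10 : 0 < b + 1 by lra.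
have ka0 : 0 < ka by rewrite divr_gt0.
have kab x : 0 <= x -> x <= b -> 0 <= ka * x <= pi.
  move=> x0 xb; rewrite mulr_ge0 ?(ltW ka0)//= /ka mulrAC ler_pdivrMr//.
  by rewrite ler_wpM2l ?(ltW pi0)//; lra.
have kabl x : x <= b -> ka * x < pi.
  by move=> xb; rewrite /ka mulrAC ltr_pdivrMr// ltr_pM2l//; lra.
have cN x : cos (ka * `|x|) = cos (ka * x).
  have [x0|x0] := leP 0 x; first by rewrite ger0_norm.
  by rewrite ltr0_norm// mulrN cosN.
have y1N : -1 < cos (ka * eps).
  rewrite -cospi ltr_cos ?in_itv/=; first exact: kabl.
    by apply: kab => //; lra.
  by rewrite lexx (ltW pi0).
have y10 : cos (ka * eps) < cos (ka * (eps - r)).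
  rewrite ltr_cos ?in_itv/=; first by rewrite ltr_pM2l//; lra.
    by apply: kab; lra.
  by apply: kab; lra.
have [p [p01 p1 p0]] := bump_poly _ _ _ e y1N y10 (cos_le1 _) e0.
have pcos x : 0 <= p.[cos (ka * x)] <= 1.
  by apply: p01; rewrite cos_geN1 cos_le1.
have [mF Fb cF] := grid_approx_poly _ _ _ _ _ eps t ka X p mX ccos.
have low : (1 - e) * fine (P A) <= Rintegral P setT ((fun x => p.[cos (ka * x)]) \o X).
  have iA := integrable_indic P mA.
  have -> : fine (P A) = Rintegral P setT (\1_A).
    by rewrite /Rintegral integral_indic// setIT.
  rewrite -RintegralZl//.
  have iF := bounded_comp_integrable _ _ _ P X _ mX mF Fb.
  have i1A : P.-integrable setT (EFin \o (fun w => (1 - e) * \1_A w)).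
    have := integrableZl measurableT (1 - e) iA.
    by apply: eq_integrable => // x _; rewrite /= EFinM.
  apply: (le_Rintegral measurableT i1A iF) => w _ /=.
  rewrite indicE; case: (boolP (w \in A)) => wA; last first.
    by rewrite mulr0; case/andP: (pcos (X w)).
  rewrite mulr1; apply: p1; rewrite cos_geN1/= -cN.
  move: wA; rewrite inE /A/= => /andP[h1 h2].
  have /andP[_ h3] := kab `|X w| (normr_ge0 _) h2.
  apply: ler_cos_pi => //; first by rewrite mulr_ge0// ltW.
  by rewrite ler_wpM2l// ltW.
suff : Rintegral P setT ((fun x => p.[cos (ka * x)]) \o X) <= B + e + e.
  have := ler_wpM2l (ltW e0) P1; rewrite /e in low *; lra.
have [m hm] := @filter_ex _ _ eventually_filter _ (filterI hB (cF e e0)).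
have [n [[tn gB] gF]] := @filter_ex _ _ eventually_filter _ (filterI hm.1 hm.2).
have gle : grid_law nu eps t m n (fun x => p.[cos (ka * x)]) <=
    grid_law nu eps t m n (fun x => (eps - r <= `|x|)%R%:R) + e.
  rewrite /grid_law; set q := fun j => _ * _; set v := fun j => _ * _.
  have q0 j : 0 <= q j by rewrite mulr_ge0 ?divr_ge0// fine_ge0.
  have b0 : 0 <= 1 - 2 * \sum_(1 <= j < 2 * m) q j.
    rewrite /q -mulr_sumr subr_ge0.
    case: (posnP n) => [->|n0]; first by rewrite invr0 mulr0 mul0r mulr0.
    have n0' : 0 < n%:R :> R by rewrite ltr0n.
    set S := \sum_(_ <= _ < _) _ in tn *.
    have -> : 2 * (t / n%:R * S) = t * (2 * S) / n%:R by ring.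
    by rewrite ler_pdivrMr// mul1r.
  apply: (@le_trans _ _ (iter n (walk q v (1 - 2 * \sum_(1 <= j < 2 * m) q j)
      (index_iota 1 (2 * m)))
      (fun x => 1 * (eps - r <= `|x|)%R%:R + 1 * e) 0)).
    apply: iter_walk_le => // x; rewrite !mul1r.
    have [h|h] := leP (eps - r) `|x|.
      by have /andP[_ h1] := pcos x; rewrite /=; lra.
    rewrite /= add0r; apply: p0; rewrite cos_le1 andbT -[leRHS]cN.
    apply: ler_cos_pi; first by rewrite mulr_ge0// ltW.
      by rewrite ler_wpM2l// ltW.
    by have /andP[] : 0 <= ka * (eps - r) <= pi by apply: kab; lra.
  rewrite (iter_walk_lin _ _ _ _ _ _ (fun=> e)) !mul1r lerD2l.
  by apply: iter_walk_cst_le => //; rewrite ?subrK// ltW.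
by move: gF; rewrite ler_norml => /andP[]; lra.
Qed.

Lemma grid_rate_le (R : realType)
    (nu : {measure set (measurableTypeR R) -> \bar R}) (f : R -> R)
    (M al dl : R) j :
  has_lebesgue_density nu f -> class_L M al f -> 0 <= M -> -1 <= al ->
  0 < dl -> (0 < j)%N -> j.+1%:R * dl <= 2 ->
  grid_rate nu dl j <= M * dl * (j%:R * dl) `^ (- (1 + al)).
Proof.
move=> den fL M0 al1 dl0 j0 j2.
have jd0 : 0 < j%:R * dl by rewrite mulr_gt0// ltr0n.
have jj : j%:R * dl <= j.+1%:R * dl by rewrite ler_wpM2r ?ler_nat ?(ltW dl0).
have h := class_L_itv _ nu f M al _ _ den fL M0 al1 jd0 jj j2.
rewrite (_ : j.+1%:R * dl - j%:R * dl = dl) in h; last by rewrite -natr1; ring.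
by rewrite /grid_rate -lee_fin fineK// ge0_fin_numE// (le_lt_trans h) ?ltry.
Qed.

(** The bound of [walk_tail_stable] holds for all large m and then n, uniformly in the cutoff of
    [law_annulus_le], so it survives the limits. *)
Lemma small_jumps_tail (R : realType) (d : measure_display) (T : measurableType d)
    (P : probability T R)
    (nu : {measure set (measurableTypeR R) -> \bar R}) (f : R -> R)
    (eps al M t Psi : R) (X : R -> {RV P >-> R}) :
  levy_measure nu -> symmetric_measure nu -> has_lebesgue_density nu f ->
  0 < eps -> eps <= 1 -> 1 <= al < 2 -> 0 < M -> class_L M al f ->
  small_jumps_process P nu eps X -> 0 < t ->
  let eta := eps / 2 in
  let w := 2 * M * t * eta `^ (- al) / (2 - al) in
  let tau := t `^ (1 / al) in
  let c := M * eta `^ (- (1 + al)) in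
  w < 1 -> tau < eta ->
  (forall dl m k, 0 < dl -> m%:R * dl = eta -> (0 < k <= m)%N ->
    tau <= k%:R * dl ->
    \sum_(1 <= j < m.+1)
      dl * (huber (k%:R * dl) (j%:R * dl) * (j%:R * dl) `^ (- (1 + al))) <= Psi) ->
  (P [set w | (eps <= `|X t w|)%R] <=
    (w ^+ 2 / 8 * expR (2 + expR (-1)) + t * c * (2 * M * t * Psi + tau)
     + 2 * (t * c * eta) ^+ 2)%:E)%E.
Proof.
move=> lev sym den eps0 eps1 al12 M0 fL sj t0; cbv zeta.
set eta := eps / 2; set w := 2 * M * t * _ / _; set tau := t `^ _.
set c := M * eta `^ (- (1 + al)); set B := _ + 2 * (t * c * eta) ^+ 2.
move=> w1 taueta hPsi.
have eta0 : 0 < eta by rewrite divr_gt0.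
have tau0 : 0 < tau by exact: powR_gt0.
have w0 : 0 < w.
  apply: divr_gt0; last by lra.
  by apply: mulr_gt0; [apply: mulr_gt0 => //; lra|exact: powR_gt0].
have w4 : 1 < 4 / w by rewrite ltr_pdivlMr//; lra.
set s := ln (4 / w) / eta.
have s0 : 0 < s by rewrite divr_gt0// ln_gt0.
have es0 : 0 < expR (-1) / s by rewrite divr_gt0// expR_gt0.
(* The upper bounds on the gap [r] are those under which [walk_tail_stable] absorbs it in its
   constants. *)
have [r [r0 r1 r2 r3]] : exists r, [/\ 0 < r, r <= eta, r <= tau / 16 &
    r * s <= expR (-1)].
  exists (Num.min eta (Num.min (tau / 16) (expR (-1) / s))); split.
  - by rewrite !lt_min eta0 es0 divr_gt0.
  - by rewrite ge_min lexx.
  - by rewrite !ge_min lexx orbT.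
  - by rewrite -ler_pdivlMr// !ge_min lexx !orbT.
have al1 : -1 <= al by lra.
have ccos th := grid_approx_cos _ _ _ P nu f M al eps t th X lev sym den fL
  (ltW M0) al1 eps0 eps1 (ltW t0) sj.
have mX : measurable_fun setT (X t) by [].
have hB : \forall m \near \oo, \forall n \near \oo,
    t * (2 * \sum_(1 <= j < 2 * m) grid_rate nu (eps / 2 / m%:R) j) <= n%:R /\
    grid_law nu eps t m n (fun x => (eps - r <= `|x|)%R%:R) <= B.
  near=> m.
  have m0 : (0 < m)%N by near: m; exact: nbhs_infty_gt.
  have m0' : 0 < m%:R :> R by rewrite ltr0n.
  rewrite -/eta; set dl := eta / m%:R.
  have dl0 : 0 < dl by rewrite divr_gt0.
  have mdl : m%:R * dl = eta by rewrite /dl; field; rewrite gt_eqF.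
  near=> n.
  have n0 : (0 < n)%N by near: n; exact: nbhs_infty_gt.
  have tn : t * (2 * \sum_(1 <= j < 2 * m) grid_rate nu dl j) <= n%:R.
    by near: n; exact: nbhs_infty_ger.
  split => //.
  have q0 j : 0 <= grid_rate nu dl j by exact: fine_ge0.
  have qM j : (0 < j < 2 * m)%N ->
      grid_rate nu dl j <= M * dl * (j%:R * dl) `^ (- (1 + al)).
    move=> /andP[j0 jm]; apply: grid_rate_le den fL _ _ _ _ _ => //.
      exact: ltW.
    apply: (@le_trans _ _ ((2 * m)%:R * dl)).
      by rewrite ler_wpM2r ?ler_nat ?(ltW dl0).
    by rewrite natrM -mulrA mdl /eta; lra.
  have dlt : dl <= tau / 16.
    rewrite /dl ler_pdivrMr// mulrC -ler_pdivrMr ?divr_gt0//.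
    by near: m; exact: nbhs_infty_ger.
  have := walk_tail_stable _ (grid_rate nu dl) al M t r dl Psi m n al12 M0 t0 dl0
    m0 n0 (ltW r0).
  cbv zeta; rewrite mdl => H; apply: le_trans (H _ _ _ _ _ _ _ _ _ _) => //.
  - rewrite (_ : (fun x => (eps - r <= `|x|)%R%:R) =
      (fun x => (2 * eta - r <= `|x|)%R%:R))//.
    by apply/funext => x; rewrite (_ : 2 * eta = eps)// /eta; field.
  - by move=> k km; exact: hPsi.
have hb b : eps <= b -> (P [set w | (eps <= `|X t w| <= b)%R] <= B%:E)%E.
  move=> eb; apply: (law_annulus_le _ _ _ P nu eps t r b B (X t) mX ccos) => //.
    by rewrite r0/= (le_lt_trans r1)// /eta; lra.
  exact: ltW.
pose F (k : nat) := [set w | (eps <= `|X t w| <= eps + k%:R)%R].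
(* The cutoff is removed by continuity of the probability along increasing annuli. *)
have -> : [set w | (eps <= `|X t w|)%R] = \bigcup_k F k.
  apply/seteqP; split => [x /= ex|x [k _] /= /andP[]//].
  exists (Num.truncn `|X t x|).+1 => //; rewrite /F/= ex/=.
  by apply: ler_wpDl; [exact: ltW|rewrite ltW// truncnS_gt].
have mF k : measurable (F k).
  have -> : F k = (fun w => `|X t w|) @^-1` `[eps, eps + k%:R]%classic.
    by apply/seteqP; split => x /=; rewrite in_itv.
  rewrite -[X in measurable X]setTI.
  by apply: measurableT_comp => //; exact: measurable_itv.
have ndF : {homo F : n m / (n <= m)%N >-> (n <= m)%O}.
  move=> n m nm; apply/subsetPset => x; rewrite /F/= => /andP[ex h].
  by rewrite ex (le_trans h)// lerD2l ler_nat.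
have mU : measurable (\bigcup_k F k) by exact: bigcup_measurable.
apply: cvge_to_le (nondecreasing_cvg_mu mF mU ndF) _.
by near=> k; apply: hb; rewrite lerDl.
Unshelve. all: by end_near. Qed.

Theorem theorem3 (R : realType) (d : measure_display) (T : measurableType d)
    (P : probability T R)
    (nu : {measure set (measurableTypeR R) -> \bar R}) (f : R -> R)
    (eps alpha M t : R) (Meps : R -> {RV P >-> R}) :
  levy_measure nu ->
  symmetric_measure nu ->
  has_lebesgue_density nu f ->
  0 < eps -> eps <= 1 ->
  1 <= alpha -> alpha < 2 ->
  0 < M ->
  class_L M alpha f ->
  small_jumps_process P nu eps Meps ->
  0 < t ->
  t < (eps / 2) `^ alpha * Num.min 1 ((2 - alpha) / (2 * M)) ->
  [/\ 0 < E1 alpha,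
      (1 < alpha ->
        (P [set w | (eps <= `|Meps t w|)%R] <=
         (2 `^ (2 + alpha) * M * t `^ (1 + 1 / alpha) / eps `^ (1 + alpha)
            * (1 + M / (alpha * (2 - alpha) * (alpha - 1)))
          + 2 * t ^+ 2 * M ^+ 2 * E1 alpha * eps `^ (- (2 * alpha)))%:E)%E) &
      (alpha = 1 ->
        (P [set w | (eps <= Meps t w)%R] <=
         (4 * t ^+ 2 * M ^+ 2 / eps ^+ 2
            * (expR (2 + (expR 1)^-1) + 37 / 9)
          + 4 * M * t ^+ 2 / eps ^+ 2
          + 16 * M ^+ 2 / eps ^+ 2 * t ^+ 2 * ln (eps / (2 * t)))%:E)%E)].
Proof.
move=> lev sym den eps0 eps1 al1 al2 M0 fL sj t0 tlt.
have eta0 : 0 < eps / 2 by rewrite divr_gt0.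
have al0 : 0 < alpha by lra.
have al12 : 1 <= alpha < 2 by rewrite al1.
have pe0 : 0 < (eps / 2) `^ alpha by exact: powR_gt0.
have teta : t < (eps / 2) `^ alpha.
  by apply: lt_le_trans tlt _; rewrite ger_pMr// ge_min lexx.
(* The second entry of the minimum in the bound on t says exactly that w < 1; the first gives tau <
   eps / 2. *)
have w1 : 2 * M * t * (eps / 2) `^ (- alpha) / (2 - alpha) < 1.
  have h : t < (eps / 2) `^ alpha * ((2 - alpha) / (2 * M)).
    by apply: lt_le_trans tlt _; rewrite ler_pM2l// ge_min lexx orbT.
  rewrite ltr_pdivrMr ?mul1r ?powRN ?ltr_pdivrMr//; last by lra.
  have M20 : 0 < 2 * M by rewrite mulr_gt0.
  rewrite -(ltr_pM2l M20) in h; apply: lt_le_trans h _.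
  by rewrite le_eqVlt; apply/orP; left; apply/eqP; field; rewrite gt_eqF.
have taueta : t `^ (1 / alpha) < eps / 2.
  have -> : eps / 2 = ((eps / 2) `^ alpha) `^ (1 / alpha).
    by rewrite -powRrM mul1r mulfV ?gt_eqF// powRr1// ltW.
  by apply: gt0_ltr_powR; rewrite ?nnegrE ?(ltW t0) ?(ltW pe0) ?divr_gt0.
have tau0 : 0 < t `^ (1 / alpha) by exact: powR_gt0.
have tail := fun Psi => small_jumps_tail _ _ _ P nu f eps alpha M t Psi Meps lev sym den
  eps0 eps1 al12 M0 fL sj t0 w1 taueta.
split.
- rewrite /E1; have x0 : 0 < 2 - alpha by lra.
  apply: addr_gt0; first apply: addr_gt0.
  + by rewrite divr_gt0 ?exprn_gt0// mulr_gt0// expR_gt0.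
  + by rewrite divr_gt0 ?exprn_gt0// powR_gt0.
  + by rewrite divr_gt0 ?powR_gt0// !mulr_gt0.
- move=> al_gt1; have al12' : 1 < alpha < 2 by rewrite al_gt1.
  apply: le_trans (tail _ _) _; last first.
    by rewrite lee_fin; exact: (tail_constants_gt1 _ _ _ _ _ al12' M0 t0 eps0).
  move=> dl m k dl0 mdl km tauk.
  apply: le_trans (sum_huber_grid_gt1 _ _ _ _ _ al12' dl0 km) _.
  rewrite ler_wpM2r//; first by rewrite invr_ge0 !mulr_ge0//; lra.
  (* As 1 - alpha < 0 and tau <= k dl, the power at the grid point is at most the power at tau. *)
  rewrite -opprB !powRN lef_pV2 ?posrE ?powR_gt0// ?(lt_le_trans tau0)//.
  apply: ge0_ler_powR; rewrite ?nnegrE ?(ltW tau0)//; first by lra.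
  exact: le_trans (ltW tau0) tauk.
- move=> al1E; subst alpha.
  have teps : t < eps / 2 by rewrite powRr1 // ltW in teta.
  have mabs : measurable [set w | (eps <= `|Meps t w|)%R].
    have -> : [set w | (eps <= `|Meps t w|)%R] =
        (fun w => `|Meps t w|) @^-1` `[eps, +oo[%classic.
      by apply/seteqP; split => x /=; rewrite in_itv/= andbT.
    rewrite -[X in measurable X]setTI.
    by apply: measurableT_comp => //; exact: measurable_itv.
  have mM : measurable [set w | (eps <= Meps t w)%R].
    have -> : [set w | (eps <= Meps t w)%R] = Meps t @^-1` `[eps, +oo[%classic.
      by apply/seteqP; split => x /=; rewrite in_itv/= andbT.
    by rewrite -[X in measurable X]setTI; exact: measurable_funP.
  apply: (@le_trans _ _ (P [set w | (eps <= `|Meps t w|)%R])).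
    apply: le_measure; rewrite ?inE// => w /= h.
    by apply: le_trans h (ler_norm _).
  apply: le_trans (tail (1 / 2 + ln (eps / 2 / t `^ (1 / 1))) _) _; last first.
    by rewrite lee_fin; exact: (tail_constants_1 _ _ _ _ M0 t0 teps).
  move=> dl m k dl0 mdl km tauk.
  apply: le_trans (sum_huber_grid_1 _ _ _ _ dl0 km) _.
  have a0 : 0 < k%:R * dl by exact: lt_le_trans tauk.
  rewrite mdl lerD2l ler_ln ?posrE ?divr_gt0//.
  by rewrite ler_wpM2l ?(ltW eta0)// lef_pV2 ?posrE.
Qed.
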